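(* Let $(M,\eta)$ be a contact manifold with Reeb vector field $\mathcal{R}$, and let $X\in\mathfrak{X}(M)$ be a vector field on $M$. Define the extended vector field $$\bar X=X\times(-\mathcal{R}(\eta(X))):M\to TM\times\mathbb{R},\qquad p\mapsto\big(X_p,\,-\mathcal{R}(\eta(X))(p)\big).$$ Then $\operatorname{im}(\bar X)\subseteq(TM\times\mathbb{R},\bar\eta)$ is a Legendrian submanifold if and only if $X$ is a Hamiltonian vector field, i.e. $X=X_H$ for some $H\in C^\infty(M)$.
   Context: A contact manifold $(M,\eta)$ is a $(2n+1)$-dimensional manifold $M$ with a $1$-form $\eta$ such that $\eta\wedge(d\eta)^n$ is nowhere zero. The Reeb vector field $\mathcal{R}$ is the unique vector field with $\iota_{\mathcal{R}}\eta=1$, $\iota_{\mathcal{R}}d\eta=0$. The map $\flat(v)=\iota_v d\eta+\eta(v)\eta$ is an isomorphism $TM\to T^*M$ with inverse $\sharp$. For $H\in C^\infty(M)$ the Hamiltonian vector field $X_H$ is the unique vector field with $\flat(X_H)=dH-(\mathcal{R}(H)+H)\eta$. On $TM\times\mathbb{R}$, with $t$ the coordinate on $\mathbb{R}$, set $\bar\eta=\eta^c+t\,\eta^v$, where $\eta^c$ and $\eta^v$ are the complete and vertical lifts of $\eta$ to $TM$ (pulled back to $TM\times\mathbb{R}$): if $\eta=\eta_i\,dx^i$ locally and $(x^i,v^i)$ are the induced coordinates on $TM$, then $\eta^v=\eta_i\,dx^i$ and $\eta^c=v^j\frac{\partial\eta_i}{\partial x^j}dx^i+\eta_i\,dv^i$.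 It is known that $\bar\eta$ is a contact form on $TM\times\mathbb{R}$. In a contact manifold, a submanifold $N$ is Legendrian if $TN=TN^{\perp_\Lambda}$, where $\Delta^{\perp_\Lambda}=\sharp_\Lambda(\Delta^\circ)$ with $\Delta^\circ$ the annihilator of $\Delta$ and $\sharp_\Lambda(\alpha)=\sharp\alpha-\alpha(\mathcal{R})\mathcal{R}$ (all taken with respect to the contact form of the ambient manifold). *)

(* Defs.v *)
From HB Require Import structures.
From mathcomp Require Import all_boot all_order all_algebra perm.
From mathcomp Require Import all_classical all_reals all_analysis.

Set Implicit Arguments.
Unset Strict Implicit.
Unset Printing Implicit Defensive.

Import Order.TTheory GRing.Theory Num.Theory.
Import numFieldNormedType.Exports.

Local Open Scope classical_set_scope.
Local Open Scope ring_scope.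

Definition iter_derive (R : realType) (V W : normedModType R) (s : seq V)
    (f : V -> W) : V -> W :=
  foldr (fun v g x => 'D_v g x) f s.

(* On finite-dimensional spaces and for U open this is C^oo on U: all iterated
   directional derivatives exist and are (Frechet) differentiable, hence
   continuous, on U. *)
Definition smooth_on (R : realType) (V W : normedModType R) (U : set V)
    (f : V -> W) : Prop :=
  forall (s : seq V) (x : V), U x -> differentiable (iter_derive s f) x.

(* A partial bijection between the set [cdom] and its image in R^m; [cinv] is
   meaningful only on that image, [coord] only on [cdom]. *)
Record chart (R : realType) (T : Type) (m : nat) := Chart {
  cdom : set T;
  coord : T -> 'rV[R]_m;
  cinv : 'rV[R]_m -> T }.

Definition codom_chart (R : realType) T m (c : chart R T m) : set 'rV[R]_m :=
  coord c @` cdom c.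

Definition valid_chart (R : realType) T m (c : chart R T m) : Prop :=
  (forall p, cdom c p -> cinv c (coord c p) = p) /\ open (codom_chart c).

Definition compatible (R : realType) T m (c c' : chart R T m) : Prop :=
  let U := coord c @` (cdom c `&` cdom c') in
  let U' := coord c' @` (cdom c `&` cdom c') in
  [/\ open U, open U',
      smooth_on U (coord c' \o cinv c) & smooth_on U' (coord c \o cinv c')].

(* [pref p] is a chosen chart around p.  The tangent space at p is modelled on
   'rV_m by means of it: the row vector v stands for the tangent vector at p
   whose components in the chart [pref p] are v.  Likewise the column vector a
   stands for the covector at p with components a in the chart [pref p].
   Smoothness of fields is always tested in all charts of the atlas, after
   the change of components from [pref p]. *)
Record atlas (R : realType) (T : Type) (m : nat) := Atlas {
  chart_index : Type;
  charts : chart_index -> chart R T m;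
  pref : T -> chart_index }.

Arguments charts {R T m} a i.
Arguments pref {R T m} a p.

Definition pchart (R : realType) T m (A : atlas R T m) (p : T) :=
  charts A (pref A p).

Definition pcoord (R : realType) T m (A : atlas R T m) (p : T) : 'rV[R]_m :=
  coord (pchart A p) p.

Definition smooth_atlas (R : realType) T m (A : atlas R T m) : Prop :=
  [/\ forall p, cdom (pchart A p) p,
      forall i, valid_chart (charts A i) &
      forall i j, compatible (charts A i) (charts A j)].

Definition smooth_manifold (R : realType) (M : topologicalType) m
    (A : atlas R M m) : Prop :=
  [/\ hausdorff_space M, @second_countable M, smooth_atlas A &
      forall i, let c := charts A i in
        [/\ open (cdom c),
            forall p, cdom c p -> {for p, continuous (coord c)} &
            forall x, codom_chart c x -> {for x, continuous (cinv c)}]].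

Definition pairing (R : realType) m (a : 'cV[R]_m) (v : 'rV[R]_m) : R :=
  (v *m a) 0 0.

Definition smooth_fun (R : realType) T m (A : atlas R T m) (f : T -> R) :=
  forall i, smooth_on (codom_chart (charts A i)) (f \o cinv (charts A i)).

Definition dfun (R : realType) T m (A : atlas R T m) (f : T -> R) (p : T) :
    'cV[R]_m :=
  \col_j 'D_(delta_mx 0 j) (f \o cinv (pchart A p)) (pcoord A p).

(* components in the chart c of the tangent vector v at p *)
Definition tcoord (R : realType) T m (A : atlas R T m) (c : chart R T m)
    (p : T) (v : 'rV[R]_m) : 'rV[R]_m :=
  'D_v (coord c \o cinv (pchart A p)) (pcoord A p).

(* the tangent vector at [cinv c x] whose components in the chart c are w *)
Definition tinv (R : realType) T m (A : atlas R T m) (c : chart R T m)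
    (x w : 'rV[R]_m) : 'rV[R]_m :=
  'D_w (coord (pchart A (cinv c x)) \o cinv c) x.

Definition vfield (R : realType) (T : Type) (m : nat) := T -> 'rV[R]_m.

Definition local_vf (R : realType) T m (A : atlas R T m) (X : vfield R T m)
    (c : chart R T m) (x : 'rV[R]_m) : 'rV[R]_m :=
  tcoord A c (cinv c x) (X (cinv c x)).

Definition smooth_vf (R : realType) T m (A : atlas R T m) (X : vfield R T m) :=
  forall i, smooth_on (codom_chart (charts A i)) (local_vf A X (charts A i)).

Definition form1 (R : realType) (T : Type) (m : nat) := T -> 'cV[R]_m.

Definition local_form (R : realType) T m (A : atlas R T m) (w : form1 R T m)
    (c : chart R T m) (x : 'rV[R]_m) : 'cV[R]_m :=
  \col_j pairing (w (cinv c x)) (tinv A c x (delta_mx 0 j)).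

Definition smooth_form (R : realType) T m (A : atlas R T m) (w : form1 R T m) :=
  forall i, smooth_on (codom_chart (charts A i)) (local_form A w (charts A i)).

(* dw(u, v) = (d_i w_j - d_j w_i) u^i v^j, computed in the chart [pref p] *)
Definition dform (R : realType) T m (A : atlas R T m) (w : form1 R T m) (p : T)
    (u v : 'rV[R]_m) : R :=
  let wloc := local_form A w (pchart A p) in
  'D_u (fun x => pairing (wloc x) v) (pcoord A p)
  - 'D_v (fun x => pairing (wloc x) u) (pcoord A p).

Definition kform (R : realType) (m k : nat) := ('I_k -> 'rV[R]_m) -> R.

Definition wedge (R : realType) m k l (a : kform R m k) (b : kform R m l) :
    kform R m (k + l) :=
  fun v => (k`! * l`!)%:R^-1 * \sum_(s : 'S_(k + l)) (-1) ^+ s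
    * a (fun i => v (s (lshift l i))) * b (fun i => v (s (rshift k i))).

Fixpoint wedge_pow (R : realType) m (a : kform R m 2) (n : nat) :
    kform R m (n * 2) :=
  match n return kform R m (n * 2) with
  | 0%N => fun _ => 1
  | n'.+1 => wedge a (@wedge_pow R m a n')
  end.

Arguments wedge_pow {R m} a n _.

Definition kform_of_form1 (R : realType) T m (w : form1 R T m) (p : T) :
    kform R m 1 := fun v => pairing (w p) (v ord0).

Definition kform_of_dform (R : realType) T m (A : atlas R T m)
    (w : form1 R T m) (p : T) : kform R m 2 :=
  fun v => dform A w p (v ord0) (v ord_max).

Definition contact_form (R : realType) T n (A : atlas R T (n * 2).+1)
    (w : form1 R T (n * 2).+1) : Prop :=
  smooth_form A w /\
  forall p, exists v,
    wedge (kform_of_form1 w p) (wedge_pow (kform_of_dform A w p) n) v != 0.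

(* [reeb] and [sharp] are definite descriptions (with a junk value 0); they
   are meaningful when w is a contact form. *)
Definition reeb (R : realType) T m (A : atlas R T m) (w : form1 R T m) :
    vfield R T m :=
  fun p => xget 0 [set v | pairing (w p) v = 1 /\ forall u, dform A w p v u = 0].

Definition flat (R : realType) T m (A : atlas R T m) (w : form1 R T m) (p : T)
    (v : 'rV[R]_m) : 'cV[R]_m :=
  \col_j dform A w p v (delta_mx 0 j) + pairing (w p) v *: w p.

Definition sharp (R : realType) T m (A : atlas R T m) (w : form1 R T m) (p : T)
    (a : 'cV[R]_m) : 'rV[R]_m :=
  xget 0 [set v | flat A w p v = a].

Definition hamiltonian_vf (R : realType) T m (A : atlas R T m)
    (w : form1 R T m) (H : T -> R) : vfield R T m :=
  fun p => let dH := dfun A H p in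
    sharp A w p (dH - (pairing dH (reeb A w p) + H p) *: w p).

Definition sharp_Lambda (R : realType) T m (A : atlas R T m) (w : form1 R T m)
    (p : T) (a : 'cV[R]_m) : 'rV[R]_m :=
  sharp A w p a - pairing a (reeb A w p) *: reeb A w p.

Definition annihilator (R : realType) m (D : set 'rV[R]_m) : set 'cV[R]_m :=
  [set a | forall v, D v -> pairing a v = 0].

Definition perp_Lambda (R : realType) T m (A : atlas R T m) (w : form1 R T m)
    (p : T) (D : set 'rV[R]_m) : set 'rV[R]_m :=
  sharp_Lambda A w p @` annihilator D.

Definition slice_chart (R : realType) T m (A : atlas R T m) (N : set T)
    (k : nat) (c : chart R T m) : Prop :=
  [/\ valid_chart c, forall i, compatible c (charts A i) &
      forall q, cdom c q ->
        (N q <-> forall j : 'I_m, (k <= j)%N -> coord c q 0 j = 0)].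

Definition submanifold (R : realType) T m (A : atlas R T m) (N : set T) :=
  exists k : nat, forall q, N q -> exists c : chart R T m,
    cdom c q /\ slice_chart A N k c.

(* velocities at q of the smooth curves of the ambient manifold lying in N *)
Definition tangent_space (R : realType) T m (A : atlas R T m) (N : set T)
    (q : T) : set 'rV[R]_m :=
  [set v | exists (g : R -> T) (e : R),
    [/\ 0 < e, g 0 = q,
        forall s, ball (0 : R) e s -> N (g s) /\ cdom (pchart A q) (g s),
        smooth_on (ball (0 : R) e) (coord (pchart A q) \o g) &
        derive1 (coord (pchart A q) \o g) 0 = v]].

Definition legendrian (R : realType) T m (A : atlas R T m) (w : form1 R T m)
    (N : set T) : Prop :=
  submanifold A N /\
  forall q, N q -> tangent_space A N q = perp_Lambda A w q (tangent_space A N q).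

(* (p, v) stands for the tangent vector v at p; the charts are the induced
   coordinates (x, v).  The preferred chart at (p, v) is the one induced by the
   preferred chart at p, in which (p, v) has coordinates (pcoord p, v). *)
Definition tangent_chart (R : realType) T m (A : atlas R T m)
    (c : chart R T m) : chart R (T * 'rV[R]_m) (m + m) :=
  {| cdom := [set q | cdom c q.1];
     coord := fun q => row_mx (coord c q.1) (tcoord A c q.1 q.2);
     cinv := fun y => (cinv c (lsubmx y), tinv A c (lsubmx y) (rsubmx y)) |}.

Definition tangent_atlas (R : realType) T m (A : atlas R T m) :
    atlas R (T * 'rV[R]_m) (m + m) :=
  {| charts := fun i => tangent_chart A (charts A i);
     pref := fun q => pref A q.1 |}.

Definition line_chart (R : realType) T m (c : chart R T m) :
    chart R (T * R) (m + 1) :=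
  {| cdom := [set q | cdom c q.1];
     coord := fun q => row_mx (coord c q.1) (const_mx q.2);
     cinv := fun y => (cinv c (lsubmx y), rsubmx y 0 0) |}.

Definition times_line (R : realType) T m (A : atlas R T m) :
    atlas R (T * R) (m + 1) :=
  {| charts := fun i => line_chart (charts A i);
     pref := fun q => pref A q.1 |}.

Definition vertical_lift (R : realType) T m (w : form1 R T m) :
    form1 R (T * 'rV[R]_m) (m + m) :=
  fun q => col_mx (w q.1) 0.

(* v^j (d_j w_i) dx^i + w_i dv^i, computed in the chart [pref p] *)
Definition complete_lift (R : realType) T m (A : atlas R T m)
    (w : form1 R T m) : form1 R (T * 'rV[R]_m) (m + m) :=
  fun q => col_mx
    ('D_(q.2) (local_form A w (pchart A q.1)) (pcoord A q.1)) (w q.1).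

Definition pullback_line (R : realType) T m (w : form1 R T m) :
    form1 R (T * R) (m + 1) :=
  fun q => col_mx (w q.1) 0.

Definition eta_bar (R : realType) T m (A : atlas R T m) (eta : form1 R T m) :
    form1 R (T * 'rV[R]_m * R) (m + m + 1) :=
  fun q => pullback_line (complete_lift A eta) q
    + q.2 *: pullback_line (vertical_lift eta) q.

Definition X_bar (R : realType) T m (A : atlas R T m) (eta : form1 R T m)
    (X : vfield R T m) (p : T) : T * 'rV[R]_m * R :=
  (p, X p, - pairing (dfun A (fun p' => pairing (eta p') (X p')) p) (reeb A eta p)).

(* Main.v *)
(* Put f = - R(eta(X)).  The pullback of eta_bar along X_bar is
   L_X eta + f eta = i_X d eta + d(eta(X)) + f eta.  If X = X_H, pairing flat(X)
   with the Reeb field gives H = - eta(X), and flat(X_H) = dH - (R(H) + H) eta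
   then says exactly that this pullback vanishes; conversely, if it vanishes,
   X is the Hamiltonian vector field of - eta(X).  On the other side, the tangent
   space L of im(X_bar) is the graph of a linear map on the base directions.  If
   L = L^perp, then L lies in ker eta_bar, since the image of sharp_Lambda does.
   If L lies in ker eta_bar, then d eta_bar also vanishes on L, as d commutes
   with pullbacks, and L = L^perp because the kernel of eta_bar meets the
   d eta_bar-orthogonal of L in L: subtracting an element of L one may assume
   that the base component vanishes, and for such vectors
   d eta_bar((0, b, s), (a', b', s')) = d eta(b, a') + s eta(a'). *)

From HB Require Import structures.
From mathcomp Require Import all_boot all_order all_algebra perm.
From mathcomp Require Import all_classical all_reals all_analysis.
From mathcomp Require Import ring lra.
Require Import Defs.

Set Implicit Arguments.
Unset Strict Implicit.
Unset Printing Implicit Defensive.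

Import Order.TTheory GRing.Theory Num.Theory.
Import numFieldNormedType.Exports.

Local Open Scope classical_set_scope.
Local Open Scope ring_scope.

(** * Smooth functions *)

Section Calculus.
Context {R : realType}.
Implicit Types V W : normedModType R.

(** Components of a tangent vector at p refer to the chart chosen at p, and that choice may jump
    with p. Smoothness and exterior derivatives are therefore first moved to a fixed chart, where
    the local expressions of a form are pullbacks of one another along transition maps. Schwarz's
    theorem then serves three times: d eta does not depend on the chart, the complete lift has the
    same formula in every induced chart, and the tangent spaces of the image are isotropic. The Reeb
    field and sharp are definite descriptions with a junk value, so existence has to be proved, for
    eta_bar as well as for eta. The contact condition enters only pointwise: no nonzero vector of
    ker eta is d eta-orthogonal to everything. In odd dimension a skew matrix is singular, which
    yields the Reeb vector, and this in turn makes flat invertible. Smoothness of the Reeb field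
    matters because R(eta(X)) is a coordinate of X_bar. *)

Lemma derive_chain V V' W (f : V -> V') (g : V' -> W) (x v : V) :
  differentiable f x -> differentiable g (f x) ->
  'D_v (g \o f) x = 'D_('D_v f x) g (f x).
Proof.
move=> df dg; have dgf := differentiable_comp df dg.
by rewrite !deriveE // diff_comp.
Qed.

Lemma near_eq_differentiable V W (f g : V -> W) (x : V) :
  (\near x, f x = g x) -> differentiable f x -> differentiable g x.
Proof.
move=> fg df; have gfx := nbhs_singleton fg.
(* The functions agree near x, so g inherits the first-order expansion of f, with the differential
   of f as linear part. *)
have Hg : g \o shift x = cst (g x) + 'd f x +o_ 0 id.
  apply/eqaddoP => /= _/posnumP[e].
  have /eqaddoP/(_ _ (gt0 e)) := diff_locally df.
  have : \forall h \near (0 : V), f (h + x) = g (h + x).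
    by move: fg; rewrite (near_shift 0) /=; apply: filterS => h /=; rewrite subr0.
  apply: filterS2 => h fgh H; rewrite -gfx.
  by move: H; rewrite !fctE /= fgh.
apply/diff_locallyP; rewrite (diff_unique _ Hg); last exact: diff_continuous.
by split => //; exact: diff_continuous.
Qed.

Lemma derive_addv V W (f : V -> W) (x u v : V) : differentiable f x ->
  'D_(u + v) f x = 'D_u f x + 'D_v f x.
Proof. by move=> df; rewrite !deriveE // linearD. Qed.

Lemma derive_scalev V W (f : V -> W) (x v : V) (k : R) : differentiable f x ->
  'D_(k *: v) f x = k *: 'D_v f x.
Proof. by move=> df; rewrite !deriveE // linearZ. Qed.

Lemma derive_rowE n W (f : 'rV[R]_n -> W) x v : differentiable f x ->
  'D_v f x = \sum_j v 0 j *: 'D_(delta_mx 0 j) f x.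
Proof.
move=> df; rewrite {1}[v]row_sum_delta deriveE // linear_sum.
by apply: eq_bigr => j _; rewrite linearZ deriveE.
Qed.

Lemma differentiable_sumP V W (I : Type) (r : seq I) (P : pred I)
  (f : I -> V -> W) x : (forall i, P i -> differentiable (f i) x) ->
  differentiable (fun y => \sum_(i <- r | P i) f i y) x.
Proof.
move=> H.
have -> : (fun y => \sum_(i <- r | P i) f i y) = \sum_(i <- r | P i) f i.
  by apply/funext => y; rewrite fct_sumE.
by elim/big_ind : _ => // g h; apply: differentiableD.
Qed.

Lemma differentiable_mx V p q (f : V -> 'M[R]_(p, q)) x :
  (forall i j, differentiable (fun y => f y i j) x) -> differentiable f x.
Proof.
move=> H.
have -> : f = fun y => \sum_i \sum_j f y i j *: delta_mx i j.
  by apply/funext => y; rewrite -matrix_sum_delta.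
do 2 apply: differentiable_sumP => ? _.
exact: differentiableZl.
Qed.

Lemma differentiable_entry V p q (f : V -> 'M[R]_(p, q)) x i j :
  differentiable f x -> differentiable (fun y => f y i j) x.
Proof.
move=> df; apply: (@differentiable_comp _ _ _ _ f (fun N => N i j)) => //.
exact: differentiable_coord.
Qed.

Lemma derive_entry V p q (f : V -> 'M[R]_(p, q)) x v i j :
  differentiable f x -> ('D_v f x) i j = 'D_v (fun y => f y i j) x.
Proof.
by move=> df; rewrite derive_mx ?mxE //; apply: diff_derivable.
Qed.

Section Smooth.
Context {V : normedModType R} {U : set V}.
Hypothesis oU : open U.

Lemma nearU (P : V -> Prop) (x : V) : U x -> (forall y, U y -> P y) ->
  \forall y \near x, P y.
Proof.
by move=> Ux H; near=> y; apply: H; near: y; exact: open_nbhs_nbhs.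
Unshelve. all: by end_near. Qed.

(** Leibniz and chain rules do not induct well on the list of directions in [smooth_on]. Counting
    the order instead keeps a function and all its first derivatives available together at order
    n. *)
Fixpoint smooth_upto (W : normedModType R) (n : nat) (f : V -> W) : Prop :=
  (forall x, U x -> differentiable f x) /\
  if n is n'.+1 then forall v, smooth_upto n' (fun x => 'D_v f x) else True.

Lemma smooth_onP W (f : V -> W) : smooth_on U f <-> forall n, smooth_upto n f.
Proof.
split=> [H n|H s].
  elim: n f H => [|n IH] f H /=; split => //; try exact: (H [::]).
  (* [foldr] applies the last direction of the list first, so the innermost derivative is added by
     [rcons]. *)
  move=> v; apply: IH => s x Ux; have := H (rcons s v) x Ux.
  by rewrite /iter_derive foldr_rcons.
have := H (size s); elim/last_ind: s f {H} => [|s v IH] f /=.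
  by case=> H _ x; apply: H.
rewrite size_rcons => -[_ /(_ v)/IH] {}IH x /IH.
by rewrite /iter_derive foldr_rcons.
Qed.

Lemma smooth_uptoW W n (f : V -> W) : smooth_upto n.+1 f -> smooth_upto n f.
Proof.
elim: n f => [|n IH] f [df H]; split => // v.
exact: IH (H v).
Qed.

Lemma smooth_upto_ext W n (f g : V -> W) : (forall x, U x -> f x = g x) ->
  smooth_upto n f -> smooth_upto n g.
Proof.
elim: n f g => [|n IH] f g fg [df H]; split => //.
- by move=> x Ux; apply: near_eq_differentiable (df x Ux); apply: nearU.
- by move=> x Ux; apply: near_eq_differentiable (df x Ux); apply: nearU.
- move=> v; apply: IH (H v) => x Ux; apply: near_eq_derive; exact: nearU.
Qed.

Lemma smooth_upto_cst W n (a : W) : smooth_upto n (fun _ => a).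
Proof.
elim: n a => [|n IH] a; split => // v.
have -> : (fun x : V => 'D_v (fun=> a) x) = fun=> 0.
  by apply/funext => x; rewrite derive_cst.
exact: IH.
Qed.

Lemma smooth_uptoD W n (f g : V -> W) : smooth_upto n f -> smooth_upto n g ->
  smooth_upto n (fun x => f x + g x).
Proof.
elim: n f g => [|n IH] f g [df Hf] [dg Hg]; split => //.
- by move=> x Ux; apply: differentiableD; [apply: df|apply: dg].
- by move=> x Ux; apply: differentiableD; [apply: df|apply: dg].
move=> v; apply: (@smooth_upto_ext _ _ (fun x => 'D_v f x + 'D_v g x)).
  move=> x Ux; rewrite -deriveD //; apply: diff_derivable;
    [exact: df|exact: dg].
exact: IH (Hf v) (Hg v).
Qed.

Lemma smooth_uptoM n (f g : V -> R) : smooth_upto n f -> smooth_upto n g ->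
  smooth_upto n (fun x => f x * g x).
Proof.
elim: n f g => [|n IH] f g [df Hf] [dg Hg]; split => //.
- by move=> x Ux; apply: differentiableM; [apply: df|apply: dg].
- by move=> x Ux; apply: differentiableM; [apply: df|apply: dg].
move=> v; apply: (@smooth_upto_ext _ _
    (fun x => f x * 'D_v g x + g x * 'D_v f x)).
  move=> x Ux; rewrite -[LHS]/(f x *: 'D_v g x + g x *: 'D_v f x) -deriveM //.
    by apply: diff_derivable; exact: df.
  by apply: diff_derivable; exact: dg.
(* Leibniz leaves one factor undifferentiated, which is known at order n + 1 and needed at order
   n. *)
have sf : smooth_upto n f by apply: smooth_uptoW; split.
have sg : smooth_upto n g by apply: smooth_uptoW; split.
exact: smooth_uptoD (IH _ _ sf (Hg v)) (IH _ _ sg (Hf v)).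
Qed.

Lemma smooth_upto_sum W n (I : Type) (r : seq I) (P : pred I)
  (f : I -> V -> W) : (forall i, P i -> smooth_upto n (f i)) ->
  smooth_upto n (fun x => \sum_(i <- r | P i) f i x).
Proof.
move=> H; elim: r => [|i r IH].
  by apply: smooth_upto_ext (smooth_upto_cst n 0) => x _; rewrite big_nil.
have [Pi|Pi] := boolP (P i); last first.
  by apply: smooth_upto_ext IH => x _; rewrite big_cons (negbTE Pi).
by apply: smooth_upto_ext (smooth_uptoD (H i Pi) IH) => x _; rewrite big_cons Pi.
Qed.

Lemma smooth_upto_mx n p q (f : V -> 'M[R]_(p, q)) :
  smooth_upto n f <-> forall i j, smooth_upto n (fun x => f x i j).
Proof.
elim: n f => [|n IH] f; split.
- by move=> [df _] i j; split => // x Ux; apply: differentiable_entry; apply: df.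
- by move=> H; split => // x Ux; apply: differentiable_mx => i j; have [] := H i j; auto.
- move=> [df H] i j; split.
    by move=> x Ux; apply: differentiable_entry; apply: df.
  move=> v; have /IH/(_ i j) := H v; apply: smooth_upto_ext => x Ux.
  by apply: derive_entry; apply: df.
- move=> H.
  have df x : U x -> differentiable f x.
    by move=> Ux; apply: differentiable_mx => i j; have [] := H i j; auto.
  split => // v; apply/IH => i j; have [_ /(_ v)] := H i j.
  by apply: smooth_upto_ext => x Ux; rewrite derive_entry //; apply: df.
Qed.

(** By the chain rule the derivative is a sum of products of derivatives of f with partial
    derivatives of g composed with f. The induction must hence quantify over g, while f only loses
    one order. *)
Lemma smooth_upto_comp n k (f : V -> 'rV[R]_k) (S : set 'rV[R]_k)
   (g : 'rV[R]_k -> R) :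
  (forall x, U x -> S (f x)) -> smooth_upto n f -> smooth_on S g ->
  smooth_upto n (g \o f).
Proof.
move=> fS; elim: n g => [|n IH] g sf sg.
  split=> // x Ux; apply: differentiable_comp; last exact/(sg [::])/fS.
  by have [+ _] := sf; apply.
have dgf x : U x -> differentiable f x /\ differentiable g (f x).
  by move=> Ux; split; [have [+ _] := sf; apply|exact/(sg [::])/fS].
split=> [x Ux|v]; first by have [? ?] := dgf x Ux; apply: differentiable_comp.
apply: (@smooth_upto_ext _ _ (fun x => \sum_j
    'D_v (fun y => f y 0 j) x * ((fun z => 'D_(delta_mx 0 j) g z) \o f) x)).
  move=> x Ux; have [df dg] := dgf x Ux.
  rewrite derive_chain // derive_rowE //.
  by apply: eq_bigr => j _; rewrite derive_entry.
apply: smooth_upto_sum => j _; apply: smooth_uptoM.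
  by have /smooth_upto_mx/(_ 0 j)[_] := sf; apply.
apply: IH; first exact: smooth_uptoW.
move=> s x Sx; have := sg (rcons s (delta_mx 0 j)) x Sx.
by rewrite /iter_derive foldr_rcons.
Qed.

(** The derivative of 1/f is - (1/f)^2 f', and the induction hypothesis gives 1/f itself at the
    lower order. *)
Lemma smooth_uptoV n (f : V -> R) : (forall x, U x -> f x != 0) ->
  smooth_upto n f -> smooth_upto n (fun x => (f x)^-1).
Proof.
move=> f0; elim: n => [|n IH] [df Hf]; split => //.
- by move=> x Ux; apply: differentiableV; [exact: df|exact: f0].
- by move=> x Ux; apply: differentiableV; [exact: df|exact: f0].
move=> v; have sV : smooth_upto n (fun x => (f x)^-1).
  by apply: IH; apply: smooth_uptoW; split.
apply: (@smooth_upto_ext _ _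
    (fun x => (-1) * ((f x)^-1 * (f x)^-1 * 'D_v f x))).
  move=> x Ux; have [dx fx] := (df x Ux, f0 x Ux).
  rewrite deriveV //; last exact: diff_derivable.
  by rewrite mulN1r -invfM -expr2 scaleNr.
apply: smooth_uptoM; first exact: smooth_upto_cst.
exact: smooth_uptoM (smooth_uptoM sV sV) (Hf v).
Qed.

End Smooth.
Section SmoothOn.
Context {V : normedModType R} {U : set V}.
Hypothesis oU : open U.

Lemma smooth_on_diff W (f : V -> W) x : smooth_on U f -> U x ->
  differentiable f x.
Proof. by move=> /(_ [::]); apply. Qed.

Lemma smooth_on_ext W (f g : V -> W) : (forall x, U x -> f x = g x) ->
  smooth_on U f -> smooth_on U g.
Proof.
move=> fg /smooth_onP H; apply/smooth_onP => n; exact: smooth_upto_ext (H n).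
Qed.

Lemma smooth_on_derive W (f : V -> W) v : smooth_on U f ->
  smooth_on U (fun x => 'D_v f x).
Proof.
by move=> /smooth_onP H; apply/smooth_onP => n; have [_] := H n.+1; apply.
Qed.

Lemma smooth_on_cst W (a : W) : smooth_on U (fun _ => a).
Proof. by apply/smooth_onP => n; apply: smooth_upto_cst. Qed.

Lemma smooth_onD W (f g : V -> W) : smooth_on U f -> smooth_on U g ->
  smooth_on U (fun x => f x + g x).
Proof.
by move=> /smooth_onP F /smooth_onP G; apply/smooth_onP => n; apply: smooth_uptoD.
Qed.

Lemma smooth_onM (f g : V -> R) : smooth_on U f -> smooth_on U g ->
  smooth_on U (fun x => f x * g x).
Proof.
by move=> /smooth_onP F /smooth_onP G; apply/smooth_onP => n; apply: smooth_uptoM.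
Qed.

Lemma smooth_onN (f : V -> R) : smooth_on U f -> smooth_on U (fun x => - f x).
Proof.
move=> F; apply: smooth_on_ext (@smooth_onM (fun=> -1) f (smooth_on_cst _) F) => x _.
by rewrite mulN1r.
Qed.

Lemma smooth_onV (f : V -> R) : (forall x, U x -> f x != 0) ->
  smooth_on U f -> smooth_on U (fun x => (f x)^-1).
Proof.
by move=> f0 /smooth_onP F; apply/smooth_onP => n; apply: smooth_uptoV.
Qed.

Lemma smooth_on_sum W (I : Type) (r : seq I) (P : pred I)
  (f : I -> V -> W) : (forall i, P i -> smooth_on U (f i)) ->
  smooth_on U (fun x => \sum_(i <- r | P i) f i x).
Proof.
move=> H; apply/smooth_onP => n; apply: smooth_upto_sum => // i /H.
by move/smooth_onP; apply.
Qed.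

Lemma smooth_on_prod (I : Type) (r : seq I) (P : pred I)
  (f : I -> V -> R) : (forall i, P i -> smooth_on U (f i)) ->
  smooth_on U (fun x => \prod_(i <- r | P i) f i x).
Proof.
move=> H; elim: r => [|i r IH].
  by apply: smooth_on_ext (smooth_on_cst (1 : R)) => x _; rewrite big_nil.
have [Pi|Pi] := boolP (P i); last first.
  by apply: smooth_on_ext IH => x _; rewrite big_cons (negbTE Pi).
by apply: smooth_on_ext (smooth_onM (H i Pi) IH) => x _; rewrite big_cons Pi.
Qed.

Lemma smooth_on_mx p q (f : V -> 'M[R]_(p, q)) :
  smooth_on U f <-> forall i j, smooth_on U (fun x => f x i j).
Proof.
split=> [/smooth_onP F i j|F]; apply/smooth_onP => n.
  by have /(smooth_upto_mx oU) := F n; apply.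
by apply/(smooth_upto_mx oU) => i j; have /smooth_onP := F i j.
Qed.

Lemma smooth_on_det p (f : V -> 'M[R]_p) : smooth_on U f ->
  smooth_on U (fun x => \det (f x)).
Proof.
move=> /smooth_on_mx F; apply: smooth_on_sum => s _.
apply: smooth_onM; first exact: smooth_on_cst.
by apply: smooth_on_prod => i _; apply: F.
Qed.

Lemma smooth_on_adj p (f : V -> 'M[R]_p) : smooth_on U f ->
  smooth_on U (fun x => \adj (f x)).
Proof.
move=> /smooth_on_mx F; apply/smooth_on_mx => i j.
apply: (@smooth_on_ext _ (fun x => cofactor (f x) j i)).
  by move=> x _; rewrite mxE.
apply: smooth_onM; first exact: smooth_on_cst.
apply: smooth_on_det; apply/smooth_on_mx => k l.
by apply: smooth_on_ext (F (lift j k) (lift i l)) => x _; rewrite !mxE.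
Qed.

Lemma smooth_on_mul p q r (f : V -> 'M[R]_(p, q)) (g : V -> 'M[R]_(q, r)) :
  smooth_on U f -> smooth_on U g -> smooth_on U (fun x => f x *m g x).
Proof.
move=> /smooth_on_mx F /smooth_on_mx G; apply/smooth_on_mx => i j.
apply: (@smooth_on_ext _ (fun x => \sum_k f x i k * g x k j)).
  by move=> x _; rewrite mxE.
by apply: smooth_on_sum => k _; apply: smooth_onM; [apply: F|apply: G].
Qed.

End SmoothOn.

Lemma smooth_on_id V (U : set V) : open U -> smooth_on U (fun x : V => x).
Proof.
move=> oU; apply/smooth_onP => -[|n]; split => // v.
by apply: (smooth_upto_ext oU _ (smooth_upto_cst n v)) => x _; rewrite derive_id.
Qed.

Lemma smooth_on_lsub V (U : set V) (p q r : nat)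
  (f : V -> 'M[R]_(p, q + r)) : open U -> smooth_on U f ->
  smooth_on U (fun x => lsubmx (f x)).
Proof.
move=> oU /(smooth_on_mx oU) F; apply/(smooth_on_mx oU) => i j.
by apply: (smooth_on_ext oU _ (F i (lshift r j))) => x _; rewrite mxE.
Qed.

Lemma smooth_on_rsub V (U : set V) (p q r : nat)
  (f : V -> 'M[R]_(p, q + r)) : open U -> smooth_on U f ->
  smooth_on U (fun x => rsubmx (f x)).
Proof.
move=> oU /(smooth_on_mx oU) F; apply/(smooth_on_mx oU) => i j.
by apply: (smooth_on_ext oU _ (F i (rshift q j))) => x _; rewrite mxE.
Qed.

Lemma smooth_on_row_mx V (U : set V) (p q r : nat)
  (f : V -> 'M[R]_(p, q)) (g : V -> 'M[R]_(p, r)) : open U ->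
  smooth_on U f -> smooth_on U g ->
  smooth_on U (fun x => row_mx (f x) (g x)).
Proof.
move=> oU /(smooth_on_mx oU) F /(smooth_on_mx oU) G; apply/(smooth_on_mx oU).
move=> i j; case: (split_ordP j) => k ->.
  by apply: (smooth_on_ext oU _ (F i k)) => x _; rewrite row_mxEl.
by apply: (smooth_on_ext oU _ (G i k)) => x _; rewrite row_mxEr.
Qed.

Lemma smooth_on_comp_fun V (U : set V) k (f : V -> 'rV[R]_k)
   (S : set 'rV[R]_k) (g : 'rV[R]_k -> R) : open U ->
  (forall x, U x -> S (f x)) -> smooth_on U f -> smooth_on S g ->
  smooth_on U (g \o f).
Proof.
move=> oU fS /smooth_onP F G; apply/smooth_onP => n.
exact (smooth_upto_comp oU fS (F n) G).
Qed.

Lemma smooth_on_comp V (U : set V) k p q (f : V -> 'rV[R]_k)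
   (S : set 'rV[R]_k) (g : 'rV[R]_k -> 'M[R]_(p, q)) : open U -> open S ->
  (forall x, U x -> S (f x)) -> smooth_on U f -> smooth_on S g ->
  smooth_on U (g \o f).
Proof.
move=> oU oS fS F /(smooth_on_mx oS) G; apply/(smooth_on_mx oU) => i j.
exact: (smooth_on_comp_fun oU fS F (G i j)).
Qed.

End Calculus.

(** * Symmetry of second derivatives and pullbacks of forms *)

Section SchwarzPullback.
Context {R : realType}.
Implicit Types V W : normedModType R.

Section Schwarz.
Context {V : normedModType R} {U : set V} {f : V -> R} {x : V}.
Hypothesis (oU : open U) (Ux : U x).
Hypothesis df : forall y, U y -> differentiable f y.

(** The mean value theorem along u turns the second difference into s times a difference of ['D_u f]
    at two points, and differentiability of ['D_u f] at x expands both values. *)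
Lemma second_difference u v (e : R) : 0 < e ->
  differentiable (fun y => 'D_u f y) x ->
  \forall s \near 0^'+,
    `|f (s *: u + s *: v + x) - f (s *: u + x) - f (s *: v + x) + f x
      - s ^+ 2 * 'D_v (fun y => 'D_u f y) x|
    <= s ^+ 2 * (e * (2 * `|u| + `|v|)).
Proof.
set g := fun y => 'D_u f y => e0 dg.
have [r r0 Hr] : exists2 r : R, 0 < r & forall h, `|h| < r -> U (h + x) /\
   `|g (h + x) - g x - 'd g x h| <= e * `|h|.
  have /eqaddoP/(_ _ e0) H1 := diff_locally dg.
  have H2 : \forall h \near 0, U (h + x).
    have : \forall y \near x, U y by exact: open_nbhs_nbhs.
    by rewrite (near_shift 0) /=; apply: filterS => h /=; rewrite subr0.
  have /nbhs_ballP[r /= r0 H] : \forall h \near (0 : V), U (h + x) /\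
      `|g (h + x) - g x - 'd g x h| <= e * `|h|.
    apply: filterS2 H1 H2 => h + Uh; rewrite !fctE /= opprD addrA => Hh.
    by split.
  exists r => // h hr; apply: H.
  by rewrite -ball_normE /= sub0r normrN.
(* For a, b in [0, s] the vector a u + b v has norm at most s (|u| + |v|); the added 1 makes [c]
   positive even if u = v = 0. *)
set c := `|u| + `|v| + 1.
have c0 : 0 < c by rewrite ltr_wpDl // addr_ge0.
have aux (s p q y T L : R) : (p - q) * s - s ^+ 2 * L =
  s * ((p - y - (T + s * L)) - (q - y - T)) by ring.
near=> s.
have s0 : 0 < s by near: s; exact: nbhs_right_gt.
have sr : s * c < r.
  by rewrite -ltr_pdivlMr //; near: s; apply: nbhs_right_lt; rewrite divr_gt0.
have small a b : 0 <= a <= s -> 0 <= b <= s -> `|a *: u + b *: v| < r.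
  move=> /andP[a0 aS] /andP[b0 bS]; apply: le_lt_trans sr.
  rewrite (le_trans (ler_normD _ _)) // !normrZ (ger0_norm a0) (ger0_norm b0).
  rewrite /c mulrDr mulr1 mulrDr -[leLHS]addr0 lerD // ?(ltW s0) //.
  by rewrite lerD // ler_wpM2r.
have ss : 0 <= s <= s by rewrite lexx ltW.
have small0 a : 0 <= a <= s -> `|a *: u| < r.
  by move=> aS; have := small a 0 aS; rewrite scale0r addr0; apply; rewrite lexx ltW.
(* The second difference is [phi s - phi 0]. *)
pose phi (t : R) := f (t *: u + s *: v + x) - f (t *: u + x).
have dline w t : U (t *: u + w) ->
    is_derive t 1 (fun t => f (t *: u + w)) (g (t *: u + w)).
  move=> Uw; have dl : is_diff t (fun t : R => t *: u + w) ( *:%R ^~ u).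
    by apply: is_diff_eq; rewrite addr0.
  have dc : differentiable (f \o (fun t : R => t *: u + w)) t.
    by apply: differentiable_comp => //; apply: df.
  apply: DeriveDef; first exact: diff_derivable.
  rewrite -[LHS]/('D_1 (f \o (fun t : R => t *: u + w)) t) derive_chain //; last exact: df.
  by rewrite [X in 'D_X f _]deriveE // diff_val scale1r.
have dphi t : 0 <= t <= s ->
    is_derive t 1 phi (g (t *: u + s *: v + x) - g (t *: u + x)).
  move=> ts; apply: is_deriveB.
    have -> : (fun t => f (t *: u + s *: v + x)) = fun t => f (t *: u + (s *: v + x)).
      by apply/funext => t'; rewrite addrA.
    rewrite -addrA; apply: dline; rewrite addrA.
    by have [] := Hr (t *: u + s *: v) (small _ _ ts ss).
  by apply: dline; have [] := Hr _ (small0 _ ts).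
have [||t tI E] := @MVT _ phi
  (fun t => g (t *: u + s *: v + x) - g (t *: u + x)) 0 s s0.
- by move=> t; rewrite in_itv /= => /andP[/ltW t0 /ltW ts]; apply: dphi; rewrite t0.
- apply: derivable_within_continuous => t; rewrite in_itv /= => ts.
  by have [] := dphi t ts.
have ts : 0 <= t <= s by move: tI; rewrite in_itv /= => /andP[/ltW-> /ltW->].
have -> : f (s *: u + s *: v + x) - f (s *: u + x) - f (s *: v + x) + f x =
   phi s - phi 0 by rewrite /phi !scale0r !add0r; ring.
rewrite E subr0 deriveE // -/g.
have [_ A1] := Hr (t *: u + s *: v) (small _ _ ts ss).
have [_ A2] := Hr (t *: u) (small0 _ ts).
rewrite linearD [X in _ - (_ + X)]linearZ /= in A1.
set p := g (t *: u + s *: v + x) in A1 *; set q := g (t *: u + x) in A2 *.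
(* The term t u contributes equally at both points and cancels; what remains is s times the
   differential at v, plus the two error terms. *)
have -> : (p - q) * s - s ^+ 2 * 'd g x v =
   s * ((p - g x - ('d g x (t *: u) + s *: 'd g x v)) -
        (q - g x - 'd g x (t *: u))).
  exact: aux.
rewrite normrM (gtr0_norm s0) expr2 -mulrA ler_pM2l //.
apply: le_trans (ler_normB _ _) _.
apply: le_trans (lerD A1 A2) _.
rewrite -mulrDr mulrCA ler_pM2l //.
have tn : `|t *: u| <= s * `|u|.
  case/andP: ts => t0 tS; rewrite normrZ (ger0_norm t0); exact: ler_wpM2r.
apply: le_trans (lerD (ler_normD _ _) tn) _.
rewrite [`|s *: v|]normrZ (gtr0_norm s0).
lra.
Unshelve. all: by end_near. Qed.

End Schwarz.

(* Both mixed derivatives are the limit of the symmetric second difference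
   quotient. *)
Lemma derive_comm V (U : set V) (f : V -> R) x u v : open U -> U x ->
  smooth_on U f ->
  'D_u (fun y => 'D_v f y) x = 'D_v (fun y => 'D_u f y) x.
Proof.
move=> oU Ux sf; have df y : U y -> differentiable f y by apply: smooth_on_diff.
apply/eqP; rewrite -subr_eq0 -normr_le0; apply/ler_addgt0Pl => e e0.
rewrite addr0.
(* Sum of the constants of the two error bounds, with 1 added for positivity. Accuracy [e / c] in
   each then gives a total error of at most s^2 e. *)
set c := (2 * `|u| + `|v|) + (2 * `|v| + `|u|) + 1.
have c0 : 0 < c by rewrite /c ltr_wpDl // !addr_ge0 // mulr_ge0.
have ec0 : 0 < e / c by rewrite divr_gt0.
have H1 := second_difference oU Ux df v ec0 (smooth_on_diff (smooth_on_derive u sf) Ux).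
have H2 := second_difference oU Ux df u ec0 (smooth_on_diff (smooth_on_derive v sf) Ux).
have [s [[s0 B1] B2]] := filter_ex (filterI (filterI (nbhs_right_gt (0:R)) H1) H2).
have s2 : 0 < s ^+ 2 by rewrite exprn_gt0.
rewrite -(ler_pM2l s2) -[X in X * _](gtr0_norm s2) -normrM.
set A := 'D_u _ x in B2 *; set B := 'D_v _ x in B1 *.
(* After this swap both second differences are built from the same four values of f. *)
move: B1 B2; rewrite [s *: v + s *: u]addrC.
set p := f _; set q := f _; set r := f _ => B1 B2.
have -> : s ^+ 2 * (A - B) =
  (p - q - r + f x - s ^+ 2 * B) - (p - r - q + f x - s ^+ 2 * A) by ring.
apply: le_trans (ler_normB _ _) _; apply: le_trans (lerD B1 B2) _.
rewrite -mulrDr ler_pM2l // -mulrDr mulrAC ler_pdivrMr // ler_pM2l //.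
by rewrite /c lerDl.
Qed.

Lemma derive_comm_mx V p q (U : set V) (f : V -> 'M[R]_(p, q)) x u v :
  open U -> U x -> smooth_on U f ->
  'D_u (fun y => 'D_v f y) x = 'D_v (fun y => 'D_u f y) x.
Proof.
move=> oU Ux sf; apply/matrixP => i j.
have E a b : ('D_a (fun y => 'D_b f y) x) i j =
    'D_a (fun y => 'D_b (fun z => f z i j) y) x.
  have dD := smooth_on_diff (smooth_on_derive b sf) Ux.
  rewrite (derive_entry a i j dD); apply: near_eq_derive.
  apply: nearU Ux _ => // y Uy; apply: derive_entry.
  exact: smooth_on_diff sf Uy.
apply: etrans (E u v) _; apply: etrans _ (esym (E v u)).
apply: (derive_comm _ _ oU Ux); exact: (proj1 (smooth_on_mx oU f) sf).
Qed.

Lemma derive_pairing V m (a : V -> 'cV[R]_m) (b : V -> 'rV[R]_m) x u :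
  differentiable a x -> differentiable b x ->
  'D_u (fun y => pairing (a y) (b y)) x =
  pairing ('D_u a x) (b x) + pairing (a x) ('D_u b x).
Proof.
move=> da db.
have -> : (fun y => pairing (a y) (b y)) = \sum_j (fun y => b y 0 j * a y j 0).
  by apply/funext => y; rewrite /pairing mxE fct_sumE.
have D j : derivable (fun y => b y 0 j * a y j 0) x u.
  apply: diff_derivable; apply: differentiableM; exact: differentiable_entry.
rewrite derive_sum // /pairing !mxE -big_split /=; apply: eq_bigr => j _.
rewrite (derive_entry u j 0 da) (derive_entry u 0 j db).
rewrite deriveM; first by congr (_ + _); exact: mulrC.
  by apply: diff_derivable; exact: differentiable_entry.
by apply: diff_derivable; exact: differentiable_entry.
Qed.

Lemma pairingDl m (a b : 'cV[R]_m) v : pairing (a + b) v = pairing a v + pairing b v.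
Proof. by rewrite /pairing mulmxDr mxE. Qed.

Lemma pairingZl m k (a : 'cV[R]_m) v : pairing (k *: a) v = k * pairing a v.
Proof. by rewrite /pairing -scalemxAr mxE. Qed.

Lemma pairingBl m (a b : 'cV[R]_m) v : pairing (a - b) v = pairing a v - pairing b v.
Proof. by rewrite -scaleN1r pairingDl pairingZl mulN1r. Qed.

Lemma pairingDr m (a : 'cV[R]_m) u v : pairing a (u + v) = pairing a u + pairing a v.
Proof. by rewrite /pairing mulmxDl mxE. Qed.

Lemma pairingZr m k (a : 'cV[R]_m) v : pairing a (k *: v) = k * pairing a v.
Proof. by rewrite /pairing -scalemxAl mxE. Qed.

Lemma pairingBr m (a : 'cV[R]_m) u v : pairing a (u - v) = pairing a u - pairing a v.
Proof. by rewrite -scaleN1r pairingDr pairingZr mulN1r. Qed.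

Lemma pairing0r m (a : 'cV[R]_m) : pairing a 0 = 0.
Proof. by rewrite /pairing mul0mx mxE. Qed.

Lemma pairing0l m (v : 'rV[R]_m) : pairing 0 v = 0.
Proof. by rewrite /pairing mulmx0 mxE. Qed.

Lemma pairing_delta m (a : 'cV[R]_m) j : pairing a (delta_mx 0 j) = a j 0.
Proof. by rewrite /pairing -rowE mxE. Qed.

Lemma pairing_colrow m k (a : 'cV[R]_m) (b : 'cV[R]_k) u v :
  pairing (col_mx a b) (row_mx u v) = pairing a u + pairing b v.
Proof. by rewrite /pairing mul_row_col mxE. Qed.

Lemma pairing_inj m (a b : 'cV[R]_m) : (forall v, pairing a v = pairing b v) -> a = b.
Proof.
by move=> H; apply/matrixP => i j; rewrite ord1 -!pairing_delta H.
Qed.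

Lemma pairing_sum m (a : 'cV[R]_m) v : pairing a v = \sum_j v 0 j * a j 0.
Proof. by rewrite /pairing mxE. Qed.

(** Differentiating before pairing makes bilinearity in u and v immediate; [dformE] identifies this
    with [dform]. *)
Definition ext_d m (w : 'rV[R]_m -> 'cV[R]_m) (x u v : 'rV[R]_m) : R :=
  pairing ('D_u w x) v - pairing ('D_v w x) u.

Definition pull_form k m (F : 'rV[R]_k -> 'rV[R]_m) (w : 'rV[R]_m -> 'cV[R]_m)
   (x : 'rV[R]_k) : 'cV[R]_k :=
  \col_j pairing (w (F x)) ('D_(delta_mx 0 j) F x).

Lemma pairing_pull k m (F : 'rV[R]_k -> 'rV[R]_m) w x u :
  differentiable F x -> pairing (pull_form F w x) u = pairing (w (F x)) ('D_u F x).
Proof.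
move=> dF; rewrite (derive_rowE u dF) pairing_sum /pairing mulmx_suml summxE.
by apply: eq_bigr => j _; rewrite mxE -[RHS]/(pairing _ _) pairingZr.
Qed.

Lemma derive_pairingl V m (a : V -> 'cV[R]_m) (b : 'rV[R]_m) x u :
  differentiable a x ->
  'D_u (fun y => pairing (a y) b) x = pairing ('D_u a x) b.
Proof.
move=> da; rewrite (derive_pairing _ da); last exact: differentiable_cst.
by rewrite derive_cst pairing0r addr0.
Qed.

Lemma derive_pairing_pull k m (U : set 'rV[R]_k) (F : 'rV[R]_k -> 'rV[R]_m) w x u v :
  open U -> U x -> smooth_on U F -> differentiable w (F x) ->
  'D_u (fun y => pairing (pull_form F w y) v) x =
  pairing ('D_('D_u F x) w (F x)) ('D_v F x) +
  pairing (w (F x)) ('D_u (fun y => 'D_v F y) x).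
Proof.
move=> oU Ux sF dw; have dF := smooth_on_diff sF Ux.
have -> : 'D_u (fun y => pairing (pull_form F w y) v) x =
    'D_u (fun y => pairing ((w \o F) y) ('D_v F y)) x.
  apply: near_eq_derive; apply: nearU Ux _ => // y Uy.
  by rewrite pairing_pull //; exact: smooth_on_diff sF Uy.
rewrite derive_pairing; last exact: smooth_on_diff (smooth_on_derive v sF) Ux.
  by rewrite derive_chain.
exact: differentiable_comp.
Qed.

Lemma ext_dE m (w : 'rV[R]_m -> 'cV[R]_m) (x u v : 'rV[R]_m) :
  differentiable w x -> ext_d w x u v =
  'D_u (fun y => pairing (w y) v) x - 'D_v (fun y => pairing (w y) u) x.
Proof.
move=> dw.
by rewrite /ext_d (derive_pairingl v u dw) (derive_pairingl u v dw).
Qed.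

(* d commutes with pullbacks because second derivatives of F are symmetric *)
Lemma ext_d_pull k m (U : set 'rV[R]_k) (F : 'rV[R]_k -> 'rV[R]_m) w x u v :
  open U -> U x -> smooth_on U F -> differentiable w (F x) ->
  differentiable (pull_form F w) x ->
  ext_d (pull_form F w) x u v = ext_d w (F x) ('D_u F x) ('D_v F x).
Proof.
move=> oU Ux sF dw dp; apply: etrans (ext_dE _ _ dp) _.
have aux (a b c d a' c' : R) : a' = a + b -> c' = c + d -> b = d ->
  a' - c' = a - c by move=> -> -> ->; ring.
apply: aux (derive_pairing_pull u v oU Ux sF dw)
  (derive_pairing_pull v u oU Ux sF dw) _.
by rewrite (derive_comm_mx u v oU Ux sF).
Qed.

Lemma smooth_on_pairing V (U : set V) m (a : V -> 'cV[R]_m) (b : V -> 'rV[R]_m) :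
  open U -> smooth_on U a -> smooth_on U b ->
  smooth_on U (fun x => pairing (a x) (b x)).
Proof.
by move=> oU sa sb; apply: (proj1 (smooth_on_mx oU _) (smooth_on_mul oU sb sa)).
Qed.

End SchwarzPullback.

(** * Linear algebra of contact forms *)

Section ContactAlgebra.
Context {R : realType}.

Definition upd m k (v : 'I_k -> 'rV[R]_m) (i : 'I_k) (x : 'rV[R]_m) :=
  fun j => if j == i then x else v j.

Definition multilinear m k (a : kform R m k) :=
  forall v i (c : R) (x y : 'rV[R]_m),
  a (upd v i (c *: x + y)) = c * a (upd v i x) + a (upd v i y).

(** The contraction with z vanishes in every slot; all slots are listed since [a] is not assumed
    alternating. *)
Definition kills m k (a : kform R m k) (z : 'rV[R]_m) :=
  forall v i, v i = z -> a v = 0.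

Definition alternates m k (a : kform R m k) :=
  forall v i j, i != j -> v i = v j -> a v = 0.

Lemma upd_same m k (v : 'I_k -> 'rV[R]_m) i : upd v i (v i) = v.
Proof. by apply/funext => j; rewrite /upd; case: eqP => // ->. Qed.

Lemma multilinear0 m k (a : kform R m k) v i :
  multilinear a -> a (upd v i 0) = 0.
Proof. by move=> /(_ v i (-1) 0 0); rewrite scaler0 addr0 mulN1r addNr. Qed.

Lemma multilinear_sum m k (a : kform R m k) v i (I : Type) (r : seq I) c
    (x : I -> 'rV[R]_m) : multilinear a ->
  a (upd v i (\sum_(l <- r) c l *: x l)) = \sum_(l <- r) c l * a (upd v i (x l)).
Proof.
move=> la; elim: r => [|l r IH].
  by rewrite !big_nil multilinear0.
by rewrite !big_cons la IH.
Qed.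

(* Some vector of the span of the v_l, either 0 or z, has a nonzero v_i
   component; putting it in place of v_i multiplies a v by that component. *)
Lemma top_form_kills0 m (a : kform R m m) z v : multilinear a ->
  alternates a -> kills a z -> z != 0 -> a v = 0.
Proof.
move=> la aa kz z0.
suff [c [c0 Hc]] : exists c : 'rV[R]_m, c != 0 /\
    forall i, a (upd v i (\sum_l c 0 l *: v l)) = 0.
  have [i ci] : exists i, c 0 i != 0.
    apply/existsP; apply: contraNT c0; rewrite negb_exists => /forallP H.
    by apply/eqP/rowP => i; rewrite mxE; apply/eqP; rewrite -[_ == _]negbK H.
  have := Hc i; rewrite multilinear_sum // (bigD1 i) //= upd_same big1 ?addr0.
    by move/eqP; rewrite mulf_eq0 (negbTE ci) => /eqP.
  move=> l li; rewrite (aa _ i l) ?mulr0 1?eq_sym // /upd eqxx.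
  by rewrite (negbTE li).
pose A := \matrix_i v i; have EA (c : 'rV[R]_m) : c *m A = \sum_l c 0 l *: v l.
  by rewrite mulmx_sum_row; apply: eq_bigr => l _; rewrite rowK.
have [dA|dA] := eqVneq (\det A) 0.
  have /eqP/det0P[c c0 cA] := dA; exists c; split => // i.
  by rewrite -EA cA multilinear0.
have uA : A \in unitmx by rewrite unitmxE unitfE.
exists (z *m invmx A); split.
  by apply: contra_neq z0 => H; rewrite -[z](mulmxKV uA) H mul0mx.
by move=> i; rewrite -EA mulmxKV //; apply: (kz _ i); rewrite /upd eqxx.
Qed.

Lemma kills_wedge m k l (a : kform R m k) (b : kform R m l) z :
  kills a z -> kills b z -> kills (wedge a b) z.
Proof.
move=> ka kb v i vi; rewrite /wedge big1 ?mulr0 // => s _.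
have [t st] : exists t, s t = i by exists ((s^-1)%g i); rewrite permKV.
move: st; case: (split_ordP t) => j -> sj.
  by rewrite (ka _ j) ?mulr0 ?mul0r // sj.
by rewrite (kb _ j) ?mulr0 // sj.
Qed.

(** Composing each permutation with the transposition of i and j flips its sign and, as v i = v j,
    keeps the values. The sum equals its own opposite, hence is 0 in characteristic 0. *)
Lemma alternates_wedge m k l (a : kform R m k) (b : kform R m l) :
  alternates (wedge a b).
Proof.
move=> v i j ij vij.
pose F (s : 'S_(k + l)) : R := (-1) ^+ s
  * a (fun i => v (s (lshift l i))) * b (fun i => v (s (rshift k i))).
suff H : \sum_s F s = - \sum_s F s.
  transitivity ((k`! * l`!)%:R^-1 * (0 : R)); last exact: mulr0.
  congr (_ * _); move/eqP: H; rewrite -addr_eq0 -mulr2n mulrn_eq0 => /eqP H.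
  exact: H.
rewrite {1}(reindex_inj (mulIg (tperm i j))) /= -sumrN; apply: eq_bigr => s _.
have vt x : v ((s * tperm i j)%g x) = v (s x).
  by rewrite permM; case: tpermP => // ->.
rewrite /F odd_permM odd_tperm ij addbT signrN !mulNr; congr (- (_ * _ * _)).
  by congr a; apply/funext => x; rewrite vt.
by congr b; apply/funext => x; rewrite vt.
Qed.

(** In the term of s, slot i is fed to exactly one of the two factors, at the position t with s t =
    i. *)
Lemma multilinear_wedge m k l (a : kform R m k) (b : kform R m l) :
  multilinear a -> multilinear b -> multilinear (wedge a b).
Proof.
move=> la lb v i c x y; rewrite /wedge mulrCA -mulrDr; congr (_ * _).
rewrite mulr_sumr -big_split /=; apply: eq_bigr => s _.
have auxl (S A B T d : R) : S * (d * A + B) * T = d * (S * A * T) + S * B * T.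
  by ring.
have auxr (S A B T d : R) : S * T * (d * A + B) = d * (S * T * A) + S * T * B.
  by ring.
have [t st] : exists t, s t = i by exists ((s^-1)%g i); rewrite permKV.
have E w t' : upd v i w (s t') = if t' == t then w else v (s t').
  by rewrite /upd -st (inj_eq perm_inj).
case: (split_ordP t) => j tj.
  have Ea w : (fun i' => upd v i w (s (lshift l i'))) =
      upd (fun i' => v (s (lshift l i'))) j w.
    by apply/funext => q; rewrite E /upd tj (inj_eq (@lshift_inj _ _)).
  have Eb w : (fun i' => upd v i w (s (rshift k i'))) =
      (fun i' => v (s (rshift k i'))).
    by apply/funext => q; rewrite E tj eq_rlshift.
  by rewrite (Ea (c *: x + y)) (Ea x) (Ea y) (Eb (c *: x + y)) (Eb x) (Eb y) la auxl.
have Ea w : (fun i' => upd v i w (s (rshift k i'))) =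
    upd (fun i' => v (s (rshift k i'))) j w.
  by apply/funext => q; rewrite E /upd tj (inj_eq (@rshift_inj _ _)).
have Eb w : (fun i' => upd v i w (s (lshift l i'))) =
    (fun i' => v (s (lshift l i'))).
  by apply/funext => q; rewrite E tj eq_lrshift.
by rewrite (Ea (c *: x + y)) (Ea x) (Ea y) (Eb (c *: x + y)) (Eb x) (Eb y) lb auxr.
Qed.

Definition skew_form m (b : 'rV[R]_m -> 'rV[R]_m -> R) :=
  (forall (c : R) (u v w : 'rV[R]_m), b (c *: u + v) w = c * b u w + b v w) /\
  (forall u v, b u v = - b v u).

Lemma skew_formP m (b : 'rV[R]_m -> 'rV[R]_m -> R) : skew_form b ->
  exists D : 'M[R]_m, D^T = - D /\ forall u v, b u v = (u *m D *m v^T) 0 0.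
Proof.
move=> [lb ab]; exists (\matrix_(i, j) b (delta_mx 0 i) (delta_mx 0 j)).
have lbs (c : 'I_m -> R) w r : b (\sum_(i <- r) c i *: delta_mx 0 i) w =
    \sum_(i <- r) c i * b (delta_mx 0 i) w.
  elim: r => [|i r IH]; last by rewrite !big_cons lb IH.
  rewrite !big_nil; have := lb (-1) 0 0 w.
  by rewrite scaler0 addr0 mulN1r addNr.
have lbr u (c : 'I_m -> R) r : b u (\sum_(i <- r) c i *: delta_mx 0 i) =
    \sum_(i <- r) c i * b u (delta_mx 0 i).
  by rewrite ab lbs -sumrN; apply: eq_bigr => i _; rewrite [in RHS]ab mulrN.
split; first by apply/matrixP => i j; rewrite !mxE ab.
move=> u v; rewrite {1}[u]row_sum_delta lbs mxE.
under [RHS]eq_bigr => j _ do rewrite mxE mulr_suml.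
rewrite exchange_big /=; apply: eq_bigr => i _.
rewrite {1}[v]row_sum_delta lbr mulr_sumr; apply: eq_bigr => j _.
by rewrite !mxE; ring.
Qed.

(** The pointwise form of the contact condition used from here on. For a skew form in odd dimension
    it amounts to the kernel of b being a line transverse to ker e. *)
Definition nondegenerate m (e : 'cV[R]_m) (b : 'rV[R]_m -> 'rV[R]_m -> R) :=
  forall z, pairing e z = 0 -> (forall u, b z u = 0) -> z = 0.

(** A nonzero z violating nondegeneracy would be killed by e and by b, hence by their wedge, a top
    form, which would then vanish. *)
Lemma wedge_nondegenerate n (e : 'cV[R]_(n * 2).+1) b v : skew_form b ->
  wedge (fun v : 'I_1 -> _ => pairing e (v ord0))
    (wedge_pow (fun v : 'I_2 -> _ => b (v ord0) (v ord_max)) n) v != 0 ->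
  nondegenerate e b.
Proof.
move=> [lb ab] w0 z ez bz; apply: contraNeq w0 => z0; apply/eqP.
set a := fun v : 'I_1 -> _ => _; set B := fun v : 'I_2 -> _ => _.
have la : multilinear a.
  by move=> u i c x y; rewrite /a /upd !ord1 eqxx pairingDr pairingZr.
have lb2 c u x y : b u (c *: x + y) = c * b u x + b u y.
  by rewrite ab lb (ab x) (ab y) mulrN opprD !opprK.
have lB : multilinear B.
  move=> u i c x y; rewrite /B /upd.
  by case: i => -[|[|//]] i; rewrite -!val_eqE /= ?lb ?lb2.
have ka : kills a z by move=> u i; rewrite /a ord1 => ->.
have kB : kills B z.
  move=> u [[|[|//]] i] ui; rewrite /B.
    by rewrite -(bz (u ord_max)) -ui; congr b; congr u; apply: val_inj.
  by rewrite ab -[RHS]oppr0 -(bz (u ord0)) -ui; congr (- b _ _); congr u; apply: val_inj.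
have lp k : multilinear (wedge_pow B k).
  elim: k => [|k IH]; first by move=> ? [].
  exact: multilinear_wedge.
have kp k : kills (wedge_pow B k) z.
  elim: k => [|k IH]; first by move=> ? [].
  exact: kills_wedge.
(* The degree 1 + n * 2 of the wedge is convertible to the dimension, which the type ascription
   exploits. *)
apply: (@top_form_kills0 _ (wedge a (wedge_pow B n) : kform R (n * 2).+1 (n * 2).+1) z) => //.
- exact (multilinear_wedge la (lp n)).
- exact (@alternates_wedge _ _ _ a (wedge_pow B n)).
- exact (kills_wedge ka (kp n)).
Qed.

(** * Reeb vector and flat map in odd dimension *)

Section Odd.
Context {m : nat} {e : 'cV[R]_m} {b : 'rV[R]_m -> 'rV[R]_m -> R}.
Hypothesis (om : odd m) (sb : skew_form b) (nd : nondegenerate e b).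

(** An odd skew matrix satisfies det D = - det D, so it has a kernel vector; nondegeneracy forces e
    to be nonzero on it, and it can be normalised. *)
Lemma reeb_exists : exists r, pairing e r = 1 /\ forall u, b r u = 0.
Proof.
have [D [DT bE]] := skew_formP sb.
have dD : \det D = 0.
  have : \det D = - \det D.
    rewrite -{1}det_tr DT -scaleN1r detZ -signr_odd om expr1.
    by rewrite mulN1r.
  by move/eqP; rewrite -addr_eq0 -mulr2n mulrn_eq0 => /eqP.
have /eqP/det0P[z z0 zD] := dD.
have bz u : b z u = 0 by rewrite bE zD mul0mx mxE.
have ez : pairing e z != 0 by apply: contra_neq z0 => ez; exact: nd.
exists ((pairing e z)^-1 *: z); split; first by rewrite pairingZr mulVf.
by move=> u; rewrite bE -!scalemxAl zD mul0mx scaler0 mxE.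
Qed.

(** This is the matrix of the flat map. If z is in its kernel, evaluation at the Reeb vector gives
    e(z) = 0, then b(z, .) = 0, so z = 0. *)
Lemma flat_unit : ((\matrix_(i, j) b (delta_mx 0 i) (delta_mx 0 j)) + e *m e^T)
  \in unitmx.
Proof.
have [D [DT bE]] := skew_formP sb; have [r [er br]] := reeb_exists.
have -> : \matrix_(i, j) b (delta_mx 0 i) (delta_mx 0 j) = D.
  apply/matrixP => i j; rewrite mxE bE -rowE trmx_delta -colE.
  by rewrite !mxE.
rewrite unitmxE unitfE; apply/negP => /det0P[z z0 zD]; case/eqP: z0.
have H v : b z v + pairing e z * pairing e v = 0.
  have := congr1 (fun x => (x *m v^T) 0 0) zD.
  rewrite mulmxDr mulmxDl mul0mx mxE [RHS]mxE -bE => <-; congr (_ + _).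
  rewrite mulmxA -(mulmxA (z *m e)) [RHS]mxE big_ord1; congr (_ * _).
  by rewrite -trmx_mul [RHS]mxE.
have ez : pairing e z = 0.
  by have := H r; rewrite sb.2 br er oppr0 add0r mulr1.
by apply: nd => // u; have := H u; rewrite ez mul0r addr0.
Qed.

Lemma flat_surj a : exists v, forall u,
  b v u + pairing e v * pairing e u = pairing a u.
Proof.
have uF := flat_unit; have [D [DT bE]] := skew_formP sb.
set F := _ + _ in uF; exists (a^T *m invmx F) => u; set v := _ *m _.
have FE : F = D + e *m e^T.
  rewrite /F; congr (_ + _); apply/matrixP => i j.
  by rewrite mxE bE -rowE trmx_delta -colE !mxE.
have vF : v *m F = a^T by rewrite /v mulmxKV.
have eu : pairing e u = (e^T *m u^T) 0 0 by rewrite -trmx_mul [RHS]mxE.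
have veu : pairing e v * pairing e u = (v *m (e *m e^T) *m u^T) 0 0.
  by rewrite mulmxA -(mulmxA (v *m e)) [RHS]mxE big_ord1 eu.
have addE (M N : 'M[R]_(1, 1)) : M 0 0 + N 0 0 = (M + N) 0 0 by rewrite mxE.
by rewrite bE veu addE -mulmxDl -mulmxDr -FE vF -trmx_mul [LHS]mxE.
Qed.

End Odd.
End ContactAlgebra.

Local Opaque derive.

(** * Change of charts *)

Section AtlasTheory.
Context {R : realType}.

Lemma skew_ext_d m (w : 'rV[R]_m -> 'cV[R]_m) x : differentiable w x ->
  skew_form (ext_d w x).
Proof.
move=> d; split => [c u v z|u v]; last by rewrite /ext_d opprB.
have aux (k a b e f X Y : R) : X = k * a + b -> Y = k * e + f ->
  X - Y = k * (a - e) + (b - f) by move=> -> ->; ring.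
apply: aux; last by rewrite pairingDr pairingZr.
by rewrite (derive_addv _ _ d) (derive_scalev _ _ d) pairingDl pairingZl.
Qed.

Lemma ext_d_near m (w w' : 'rV[R]_m -> 'cV[R]_m) x u v :
  (\forall y \near x, w y = w' y) -> ext_d w x u v = ext_d w' x u v.
Proof.
by move=> H; rewrite /ext_d (near_eq_derive u H) (near_eq_derive v H).
Qed.

Definition trans T m (c c' : chart R T m) : 'rV[R]_m -> 'rV[R]_m :=
  coord c' \o cinv c.

Definition overlap T m (c c' : chart R T m) : set 'rV[R]_m :=
  coord c @` (cdom c `&` cdom c').

Section Charts.
Context {T : Type} {m : nat}.
Implicit Types c : chart R T m.

Lemma coordK c p : valid_chart c -> cdom c p -> cinv c (coord c p) = p.
Proof. by move=> [H _]; apply: H. Qed.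

Lemma codomP c x : valid_chart c -> codom_chart c x ->
  cdom c (cinv c x) /\ coord c (cinv c x) = x.
Proof. by move=> vc [p cp <-]; rewrite (coordK vc cp). Qed.

Lemma overlapP c c' x : valid_chart c ->
  overlap c c' x <-> codom_chart c x /\ cdom c' (cinv c x).
Proof.
move=> vc; split=> [[p [cp cp'] <-]|[[p cp <-]]]; rewrite (coordK vc cp).
  by split => //; exists p.
by move=> cp'; exists p.
Qed.

Lemma overlap_coord c c' p : cdom c p -> cdom c' p -> overlap c c' (coord c p).
Proof. by move=> cp cp'; exists p. Qed.

Lemma overlap_self c : overlap c c = codom_chart c.
Proof. by rewrite /overlap setIid. Qed.

Lemma trans_coord c c' p : valid_chart c -> cdom c p ->
  trans c c' (coord c p) = coord c' p.
Proof. by move=> vc cp; rewrite /trans /= coordK. Qed.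

Lemma trans_overlap c c' x : valid_chart c -> overlap c c' x ->
  overlap c' c (trans c c' x).
Proof.
by move=> vc [p [cp cp'] <-]; rewrite trans_coord //; exists p.
Qed.

Lemma cinv_trans c c' x : valid_chart c -> valid_chart c' -> overlap c c' x ->
  cinv c' (trans c c' x) = cinv c x.
Proof.
by move=> vc vc' [p [cp cp'] <-]; rewrite trans_coord // !coordK.
Qed.

Lemma compatible_overlap c c' :
  open (overlap c c') -> open (overlap c' c) ->
  smooth_on (overlap c c') (trans c c') ->
  smooth_on (overlap c' c) (trans c' c) -> compatible c c'.
Proof.
have E : cdom c' `&` cdom c = cdom c `&` cdom c' by rewrite setIC.
by rewrite /overlap E => *; split.
Qed.

Lemma open_overlap c c' : compatible c c' -> open (overlap c c').
Proof. by case. Qed.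

Lemma smooth_trans c c' : compatible c c' -> smooth_on (overlap c c') (trans c c').
Proof. by case. Qed.

Lemma compatible_sym c c' : compatible c c' -> compatible c' c.
Proof.
rewrite /compatible [cdom c' `&` _]setIC => -[*]; split; assumption.
Qed.

Lemma trans_diff c c' x : compatible c c' -> overlap c c' x ->
  differentiable (trans c c') x.
Proof. by move=> cc' ox; exact: smooth_on_diff (smooth_trans cc') ox. Qed.

(** Cocycle rule for derivatives of transition maps. Since [tcoord] and [tinv] are derivatives of
    transitions out of and into preferred charts, their inversion and change-of-chart laws are
    instances of it. *)
Lemma derive_trans c c' c'' x w : valid_chart c -> valid_chart c' ->
  compatible c c' -> compatible c' c'' -> compatible c c'' ->
  overlap c c' x -> overlap c c'' x ->
  'D_('D_w (trans c c') x) (trans c' c'') (trans c c' x) = 'D_w (trans c c'') x.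
Proof.
move=> vc vc' cc' c'c'' cc'' ox ox''.
have ox' : overlap c' c'' (trans c c' x).
  apply/(overlapP _ _ vc'); rewrite (cinv_trans vc vc' ox).
  have /overlapP[//|? ?] := ox''; split=> //.
  by have /overlapP[//|] := trans_overlap vc ox.
rewrite -derive_chain; [|exact: trans_diff|exact: trans_diff].
apply: near_eq_derive; apply: (nearU (open_overlap cc')) ox _ => y oy.
by rewrite /= {1}/trans /= (cinv_trans vc vc' oy).
Qed.

Lemma derive_trans_id c x w : valid_chart c -> codom_chart c x ->
  'D_w (trans c c) x = w.
Proof.
move=> vc cx; rewrite -[RHS](derive_id x w); apply: near_eq_derive.
apply: (nearU vc.2) cx _ => y /(codomP vc)[_].
by [].
Qed.

End Charts.

Section Atlas.
Context {T : Type} {m : nat} {A : atlas R T m}.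
Hypothesis SA : smooth_atlas A.
Local Notation C := (charts A).
Implicit Types (i j : chart_index A) (p : T) (x u v : 'rV[R]_m).

Lemma validC i : valid_chart (C i). Proof. by case: SA. Qed.
Lemma compatC i j : compatible (C i) (C j). Proof. by case: SA. Qed.
Lemma cdom_pref p : cdom (pchart A p) p. Proof. by case: SA. Qed.
Lemma open_codom i : open (codom_chart (C i)). Proof. by have [] := validC i. Qed.
Lemma codom_coord i p : cdom (C i) p -> codom_chart (C i) (coord (C i) p).
Proof. by exists p. Qed.
Lemma codom_pcoord p : codom_chart (pchart A p) (pcoord A p).
Proof. by exists p => //; exact: cdom_pref. Qed.
Lemma cinv_pcoord p : cinv (pchart A p) (pcoord A p) = p.
Proof. by apply: coordK (cdom_pref p); exact: validC. Qed.

Lemma overlap_pref i x : codom_chart (C i) x ->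
  overlap (C i) (pchart A (cinv (C i) x)) x.
Proof.
by move=> cx; apply/(overlapP _ _ (validC i)); split => //; exact: cdom_pref.
Qed.

Lemma tcoordE i p v : tcoord A (C i) p v = 'D_v (trans (pchart A p) (C i)) (pcoord A p).
Proof. by []. Qed.

Lemma tinvE i x v : tinv A (C i) x v = 'D_v (trans (C i) (pchart A (cinv (C i) x))) x.
Proof. by []. Qed.

Lemma trans_pref i x : trans (C i) (pchart A (cinv (C i) x)) x = pcoord A (cinv (C i) x).
Proof. by []. Qed.

Lemma tcoord_linear i p : cdom (C i) p -> linear (tcoord A (C i) p).
Proof.
move=> cp k u v.
have d : differentiable (trans (pchart A p) (C i)) (pcoord A p).
  apply: trans_diff; first exact: compatC.
  by apply: overlap_coord => //; exact: cdom_pref.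
by rewrite !tcoordE (derive_addv _ _ d) (derive_scalev _ _ d).
Qed.

Lemma tinvK i x w : codom_chart (C i) x ->
  tcoord A (C i) (cinv (C i) x) (tinv A (C i) x w) = w.
Proof.
move=> cx; rewrite tcoordE tinvE -trans_pref derive_trans; first 1 last.
- exact: validC.
- exact: validC.
- exact: compatC.
- exact: compatC.
- exact: compatC.
- exact: overlap_pref.
- by rewrite overlap_self.
by apply: derive_trans_id => //; exact: validC.
Qed.

Lemma tcoordK i p v : cdom (C i) p ->
  tinv A (C i) (coord (C i) p) (tcoord A (C i) p v) = v.
Proof.
move=> cp; rewrite tinvE tcoordE (coordK (validC i) cp).
have -> : coord (C i) p = trans (pchart A p) (C i) (pcoord A p).
  by rewrite trans_coord //; [exact: validC|exact: cdom_pref].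
rewrite derive_trans; first 1 last.
- exact: validC.
- exact: validC.
- exact: compatC.
- exact: compatC.
- exact: compatC.
- by apply: overlap_coord => //; exact: cdom_pref.
- by rewrite overlap_self; exact: codom_pcoord.
by apply: derive_trans_id; [exact: validC|exact: codom_pcoord].
Qed.

Lemma tcoord_pref p v : tcoord A (pchart A p) p v = v.
Proof.
by rewrite tcoordE; apply: derive_trans_id; [exact: validC|exact: codom_pcoord].
Qed.

Lemma tinv_pref p v : tinv A (pchart A p) (pcoord A p) v = v.
Proof. by rewrite -{1}[v](tcoord_pref p) tcoordK //; exact: cdom_pref. Qed.

Lemma derive_trans_tinv i j x w : overlap (C i) (C j) x ->
  tinv A (C j) (trans (C i) (C j) x) ('D_w (trans (C i) (C j)) x) =
  tinv A (C i) x w.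
Proof.
move=> ox; rewrite !tinvE (cinv_trans (validC i) (validC j) ox).
apply: derive_trans => //; try exact: validC; try exact: compatC.
by apply: overlap_pref; have /overlapP[|] := ox; first exact: validC.
Qed.

Section Form.
Variable w : form1 R T m.

Lemma pairing_local_form i x u : codom_chart (C i) x ->
  pairing (local_form A w (C i) x) u = pairing (w (cinv (C i) x)) (tinv A (C i) x u).
Proof.
move=> cx; have d := trans_diff (compatC _ _) (overlap_pref cx).
rewrite [RHS]/pairing tinvE (derive_rowE u d) mulmx_suml summxE pairing_sum.
by apply: eq_bigr => j _; rewrite mxE -[RHS]/(pairing _ _) pairingZr.
Qed.

Lemma local_form_pref p : local_form A w (pchart A p) (pcoord A p) = w p.
Proof.
apply: pairing_inj => v; rewrite pairing_local_form; last exact: codom_pcoord.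
by rewrite tinv_pref cinv_pcoord.
Qed.

Lemma local_form_tcoord i p v : cdom (C i) p ->
  pairing (local_form A w (C i) (coord (C i) p)) (tcoord A (C i) p v) =
  pairing (w p) v.
Proof.
move=> cp; rewrite pairing_local_form; last exact: codom_coord.
by rewrite tcoordK // (coordK (validC i) cp).
Qed.

(** Both sides evaluate w on the same tangent vector, because [tinv] is compatible with transition
    maps. *)
Lemma local_form_trans i j x : overlap (C i) (C j) x ->
  local_form A w (C i) x =
  pull_form (trans (C i) (C j)) (local_form A w (C j)) x.
Proof.
move=> ox; apply: pairing_inj => u.
have d := trans_diff (compatC _ _) ox.
have [cx _] := (overlapP _ _ (validC i)).1 ox.
have [cx' _] := (overlapP _ _ (validC j)).1 (trans_overlap (validC i) ox).
rewrite (pairing_pull _ _ d) (pairing_local_form _ cx) (pairing_local_form _ cx').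
by rewrite derive_trans_tinv // (cinv_trans (validC i) (validC j) ox).
Qed.

Hypothesis sw : smooth_form A w.

Lemma local_form_diff i x : codom_chart (C i) x ->
  differentiable (local_form A w (C i)) x.
Proof. by move=> cx; exact: smooth_on_diff (@sw i) cx. Qed.

Lemma dformE p u v :
  dform A w p u v = ext_d (local_form A w (pchart A p)) (pcoord A p) u v.
Proof. by rewrite ext_dE //; apply: local_form_diff; exact: codom_pcoord. Qed.

Lemma skew_local i x : codom_chart (C i) x ->
  skew_form (ext_d (local_form A w (C i)) x).
Proof. by move=> cx; apply: skew_ext_d; exact: local_form_diff. Qed.

Lemma skew_dform p : skew_form (dform A w p).
Proof.
have [H1 H2] := skew_local (codom_pcoord p).
by split=> *; rewrite !dformE ?H1 // H2.
Qed.

(** Chart independence of the exterior derivative: near p the two local expressions are related by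
    pullback along the transition map, and d commutes with it. *)
Lemma dform_chart i p u v : cdom (C i) p ->
  dform A w p u v = ext_d (local_form A w (C i)) (coord (C i) p)
    (tcoord A (C i) p u) (tcoord A (C i) p v).
Proof.
move=> cp; rewrite dformE.
have ox := overlap_coord (cdom_pref p) cp.
have oo := open_overlap (compatC (pref A p) i).
have st := smooth_trans (compatC (pref A p) i).
have dw : differentiable (local_form A w (C i)) (trans (pchart A p) (C i) (pcoord A p)).
  rewrite trans_coord; [|exact: validC|exact: cdom_pref].
  by apply: local_form_diff; exact: codom_coord.
have nE : \forall y \near pcoord A p, local_form A w (pchart A p) y =
    pull_form (trans (pchart A p) (C i)) (local_form A w (C i)) y.
  by apply: (nearU oo) ox _ => y oy; rewrite -local_form_trans.
have dp : differentiable (pull_form (trans (pchart A p) (C i)) (local_form A w (C i))) (pcoord A p).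
  apply: near_eq_differentiable nE _; apply: local_form_diff; exact: codom_pcoord.
rewrite (ext_d_near u v nE); apply: etrans (ext_d_pull u v oo ox st dw dp) _.
by rewrite trans_coord; [|exact: validC|exact: cdom_pref].
Qed.

End Form.

Lemma cdom_nearE i j x : overlap (C i) (C j) x -> \forall y \near x, overlap (C i) (C j) y.
Proof. by move=> ox; apply: (nearU (open_overlap (compatC i j))) ox _. Qed.

Section Fun.
Variable f : T -> R.
Hypothesis sf : smooth_fun A f.

Lemma dfun_chart i p v : cdom (C i) p -> pairing (dfun A f p) v =
  'D_(tcoord A (C i) p v) (f \o cinv (C i)) (coord (C i) p).
Proof.
move=> cp.
have d : differentiable (f \o cinv (pchart A p)) (pcoord A p).
  by apply: smooth_on_diff (@sf _) _; exact: codom_pcoord.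
have -> : pairing (dfun A f p) v = 'D_v (f \o cinv (pchart A p)) (pcoord A p).
  by rewrite (derive_rowE v d) pairing_sum; apply: eq_bigr => j _; rewrite mxE.
have ox := overlap_coord (cdom_pref p) cp.
rewrite tcoordE -(trans_coord (C i) (validC _) (cdom_pref p)) -derive_chain.
- apply: near_eq_derive; apply: filterS (cdom_nearE ox) => y oy.
  by rewrite /= cinv_trans //; exact: validC.
- by apply: trans_diff ox; exact: compatC.
- rewrite trans_coord; [|exact: validC|exact: cdom_pref].
  by apply: smooth_on_diff (@sf _) _; exact: codom_coord.
Qed.

End Fun.

Section Pairing.
Variables (w : form1 R T m) (X : vfield R T m).

Lemma pairing_local i x : codom_chart (C i) x ->
  pairing (w (cinv (C i) x)) (X (cinv (C i) x)) =
  pairing (local_form A w (C i) x) (local_vf A X (C i) x).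
Proof.
move=> cx; have [cp E] := codomP (validC i) cx.
by apply: etrans (esym (local_form_tcoord w (X _) cp)) _; rewrite E.
Qed.

Lemma smooth_pairing : smooth_form A w -> smooth_vf A X ->
  smooth_fun A (fun p => pairing (w p) (X p)).
Proof.
move=> sw sX i.
have H := smooth_on_pairing (@open_codom i) (sw i) (sX i).
refine (smooth_on_ext (@open_codom i) _ H) => x cx.
by rewrite /= pairing_local.
Qed.

Lemma dfun_local (f : T -> R) i x : smooth_fun A f -> codom_chart (C i) x ->
  pairing (dfun A f (cinv (C i) x)) (X (cinv (C i) x)) =
  'D_(local_vf A X (C i) x) (f \o cinv (C i)) x.
Proof.
move=> sf cx; have [cp E] := codomP (validC i) cx.
by rewrite (dfun_chart sf _ cp) E.
Qed.

(** The chart in the definition of [dfun] changes with p, so smoothness is read off in a fixed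
    chart, where df(X) is the sum of X^j d_j f. *)
Lemma smooth_dfun (f : T -> R) : smooth_fun A f -> smooth_vf A X ->
  smooth_fun A (fun p => pairing (dfun A f p) (X p)).
Proof.
move=> sf sX i; refine (smooth_on_ext (@open_codom i) (f := fun x =>
  \sum_j local_vf A X (C i) x 0 j * 'D_(delta_mx 0 j) (f \o cinv (C i)) x) _ _).
  move=> x cx; rewrite /= dfun_local // derive_rowE //.
  exact: smooth_on_diff (sf i) cx.
apply: smooth_on_sum => [|j _]; first exact: @open_codom.
apply: smooth_onM; first exact: @open_codom.
  exact: (proj1 (smooth_on_mx (@open_codom i) _) (sX i)).
exact: smooth_on_derive.
Qed.

End Pairing.

(** * Reeb field and musical isomorphisms on a manifold *)

Section Reeb.
Variable w : form1 R T m.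
Hypothesis sw : smooth_form A w.
Hypothesis om : odd m.
Hypothesis nd : forall p, nondegenerate (w p) (dform A w p).

(** Existence rules out the default value of [xget]. *)
Lemma reebP p : pairing (w p) (reeb A w p) = 1 /\
  forall u, dform A w p (reeb A w p) u = 0.
Proof.
have [r Hr] := reeb_exists om (skew_dform sw p) (nd (p:=p)).
rewrite /reeb; case: xgetP => [v _ //|/(_ r)].
by case: Hr => h1 h2 []; split.
Qed.

Lemma flatE p v u : pairing (flat A w p v) u =
  dform A w p v u + pairing (w p) v * pairing (w p) u.
Proof.
rewrite /flat pairingDl pairingZl; congr (_ + _).
have [lb ab] := skew_dform sw p.
rewrite pairing_sum [in RHS]ab {2}[u]row_sum_delta.
have H (c : 'I_m -> R) r : dform A w p (\sum_(j <- r) c j *: delta_mx 0 j) v =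
   - \sum_(j <- r) c j * dform A w p v (delta_mx 0 j).
  elim: r => [|j r IH].
    rewrite !big_nil; have := lb (-1) 0 0 v.
    by rewrite scaler0 addr0 mulN1r addNr oppr0.
  by rewrite !big_cons lb IH (ab _ v) mulrN opprD.
by rewrite H opprK; apply: eq_bigr => j _; rewrite mxE.
Qed.

(** Pairing with the Reeb vector recovers w(u) = w(v); the rest of the equation says that u - v is
    dw-orthogonal to everything. *)
Lemma flat_inj p u v : flat A w p u = flat A w p v -> u = v.
Proof.
move=> E; apply/eqP; rewrite -subr_eq0; apply/eqP; apply: (nd (p := p)).
  have := congr1 (fun a => pairing a (reeb A w p)) E.
  have [h1 h2] := reebP p; have [lb ab] := skew_dform sw p.
  rewrite !flatE h1 !mulr1 (ab u) (ab v) !h2 oppr0 !add0r pairingBr => ->.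
  exact: subrr.
move=> z; have := congr1 (fun a => pairing a z) E.
have := congr1 (fun a => pairing a (reeb A w p)) E.
have [h1 h2] := reebP p; have [lb ab] := skew_dform sw p.
rewrite !flatE h1 !mulr1 (ab u) (ab v) !h2 oppr0 !add0r => -> /addIr H.
by rewrite addrC -scaleN1r lb H mulN1r addNr.
Qed.

Lemma flat_sharp p a : flat A w p (sharp A w p a) = a.
Proof.
suff [v Hv] : exists v, flat A w p v = a.
  by rewrite /sharp; case: xgetP => [u _ //|/(_ v)].
have [v Hv] := flat_surj om (skew_dform sw p) (nd (p:=p)) a.
by exists v; apply: pairing_inj => u; rewrite flatE Hv.
Qed.

Lemma sharpE p a v : flat A w p v = a -> sharp A w p a = v.
Proof. by move=> E; apply: (@flat_inj p); rewrite flat_sharp. Qed.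

(** The flat map sends the Reeb field to w. Solving this linear system by Cramer's rule in a chart
    expresses its components rationally in those of w and their first derivatives. *)
Lemma smooth_reeb : smooth_vf A (reeb A w).
Proof.
move=> i; set e := local_form A w (C i).
pose F x : 'M[R]_m := (\matrix_(k, l) ext_d e x (delta_mx 0 k) (delta_mx 0 l))
  + e x *m (e x)^T.
(* Nondegeneracy is known in the preferred chart at each point; [tinv] carries it to chart i. *)
have ndx x : codom_chart (C i) x -> nondegenerate (e x) (ext_d e x).
  move=> cx z; have [cp E] := codomP (validC i) cx.
  rewrite -[z](tinvK _ cx); set z' := tinv _ _ _ _ => ez bz.
  suff -> : z' = 0.
    by have := tcoord_linear cp (-1) 0 0; rewrite scaler0 addr0 scaleN1r addNr.
  apply: (nd (p := cinv (C i) x)).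
    by rewrite -(local_form_tcoord _ _ cp) E.
  by move=> u; rewrite (dform_chart sw _ _ cp) E.
have uF x : codom_chart (C i) x -> F x \in unitmx.
  by move=> cx; apply: flat_unit => //; [exact: skew_local|exact: ndx].
have rE x : codom_chart (C i) x -> local_vf A (reeb A w) (C i) x =
   (\det (F x))^-1 *: ((e x)^T *m \adj (F x)).
  move=> cx; have [cp E] := codomP (validC i) cx.
  have [h1 h2] := reebP (cinv (C i) x).
  set r := local_vf _ _ _ _.
  have er : pairing (e x) r = 1.
    by rewrite -h1 -(local_form_tcoord _ _ cp) E.
  have br u : ext_d e x r u = 0.
    rewrite -[u](tinvK _ cx) -{1}E -(dform_chart sw _ _ cp); exact: h2.
  have rF : r *m F x = (e x)^T.
    rewrite /F mulmxDr mulmxA.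
    have -> : r *m (e x) = 1%:M by apply/matrixP => k l; rewrite !ord1 [RHS]mxE; exact: er.
    have [D [DT bE]] := skew_formP (skew_local sw cx).
    have -> : (\matrix_(k, l) ext_d e x (delta_mx 0 k) (delta_mx 0 l)) = D.
      by apply/matrixP => k l; rewrite mxE bE -rowE trmx_delta -colE !mxE.
    have -> : r *m D = 0.
      apply/rowP => k; have := br (delta_mx 0 k).
      by rewrite bE trmx_delta -colE !mxE.
    by rewrite add0r mul1mx.
  have := uF x cx; rewrite -{1}[r](mulmxK (uF x cx)) rF /invmx => ->.
  by rewrite -scalemxAr.
have oC := @open_codom i.
have sF : smooth_on (codom_chart (C i)) F.
  apply: smooth_onD => //.
    apply/(smooth_on_mx oC) => k l.
    have s a b : smooth_on (codom_chart (C i)) (fun x => pairing ('D_a e x) b).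
      apply: smooth_on_pairing => //; last exact: smooth_on_cst.
      by apply: smooth_on_derive; exact: @sw.
    refine (smooth_on_ext oC _ (smooth_onD oC (s (delta_mx 0 k) (delta_mx 0 l))
      (smooth_onN oC (s (delta_mx 0 l) (delta_mx 0 k))))) => x _.
    by rewrite mxE.
  refine (smooth_on_mul oC (@sw i) _).
  apply/(smooth_on_mx oC) => k l.
  refine (smooth_on_ext oC _ (proj1 (smooth_on_mx oC _) (@sw i) l k)) => x _.
  by rewrite [RHS]mxE.
refine (smooth_on_ext oC (fun x cx => esym (rE x cx)) _).
apply/(smooth_on_mx oC) => k l.
have se : smooth_on (codom_chart (C i)) (fun x => (e x)^T *m \adj (F x)).
  apply: smooth_on_mul => //; last exact: smooth_on_adj.
  apply/(smooth_on_mx oC) => a b.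
  refine (smooth_on_ext oC _ (proj1 (smooth_on_mx oC _) (@sw i) b a)) => x _.
  by rewrite [RHS]mxE.
refine (smooth_on_ext oC (f := fun x => (\det (F x))^-1 * ((e x)^T *m \adj (F x)) k l) _ _).
  by move=> x _; rewrite [RHS]mxE.
apply: smooth_onM => //; last exact: (proj1 (smooth_on_mx oC _) se).
apply: smooth_onV => //; last exact: smooth_on_det.
by move=> x /uF; rewrite unitmxE unitfE.
Qed.

End Reeb.
End Atlas.
End AtlasTheory.

(** * Derivatives in varying directions and of block maps *)

Section Directional.
Context {R : realType}.

Lemma pairing_derive k (f : 'rV[R]_k -> R) (x v : 'rV[R]_k) : differentiable f x ->
  'D_v f x = pairing (\col_j 'D_(delta_mx 0 j) f x) v.
Proof.
move=> d; rewrite (derive_rowE v d) pairing_sum.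
by apply: eq_bigr => j _; rewrite mxE.
Qed.

(** Base point and direction both vary, as in the fibre coordinates of TM; expanding the direction
    in the basis reduces to partial derivatives of f at a moving point. *)
Lemma smooth_on_dir (V : normedModType R) (U : set V) k p q (S : set 'rV[R]_k)
    (x v : V -> 'rV[R]_k) (f : 'rV[R]_k -> 'M[R]_(p, q)) :
  open U -> open S -> (forall y, U y -> S (x y)) ->
  smooth_on U x -> smooth_on U v -> smooth_on S f ->
  smooth_on U (fun y => 'D_(v y) f (x y)).
Proof.
move=> oU oS US sx sv sf; apply/(smooth_on_mx oU) => i l.
have sfe := proj1 (smooth_on_mx oS _) sf i l.
refine (smooth_on_ext oU (f := fun y => \sum_j v y 0 j *
   ((fun z => 'D_(delta_mx 0 j) (fun z => f z i l) z) \o x) y) _ _).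
  move=> y Uy; have dfy := smooth_on_diff sf (US y Uy).
  rewrite (derive_entry _ _ _ dfy) derive_rowE //.
  exact: smooth_on_diff sfe (US y Uy).
apply: smooth_on_sum => // j _; apply: smooth_onM => //.
  exact: (proj1 (smooth_on_mx oU _) sv).
refine (smooth_on_comp_fun oU US sx _).
exact: smooth_on_derive.
Qed.

Lemma derive_dir (V : normedModType R) k p q (S : set 'rV[R]_k)
    (x v : V -> 'rV[R]_k) (f : 'rV[R]_k -> 'M[R]_(p, q)) (y W : V) :
  open S -> S (x y) -> differentiable x y -> differentiable v y ->
  smooth_on S f ->
  'D_W (fun y => 'D_(v y) f (x y)) y =
  'D_('D_W x y) (fun z => 'D_(v y) f z) (x y) + 'D_('D_W v y) f (x y).
Proof.
move=> oS Sx dx dv sf.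
have sfe i l := proj1 (smooth_on_mx oS _) sf i l.
(* The gradient of entry (i, l): it turns a derivative in a moving direction into a pairing, to
   which the product rule applies. *)
pose g i l z : 'cV[R]_k := \col_j 'D_(delta_mx 0 j) (fun z => f z i l) z.
have sg i l : smooth_on S (g i l).
  apply/(smooth_on_mx oS) => a b; have := smooth_on_derive (delta_mx 0 a) (sfe i l).
  by refine (smooth_on_ext oS _) => z _; rewrite mxE.
have entryE i l w z : S z -> ('D_w f z) i l = pairing (g i l z) w.
  move=> Sz; have dfz := smooth_on_diff sf Sz.
  rewrite (derive_entry _ _ _ dfz); apply: pairing_derive.
  exact: smooth_on_diff (sfe i l) Sz.
have nearS : \forall y \near y, S (x y).
  by apply: (differentiable_continuous dx); exact: open_nbhs_nbhs.
have nE i l : \forall y \near y, pairing ((g i l \o x) y) (v y) = ('D_(v y) f (x y)) i l.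
  by apply: filterS nearS => z Sz; rewrite entryE.
have dgx i l : differentiable (g i l \o x) y.
  by apply: differentiable_comp => //; exact: smooth_on_diff (sg i l) Sx.
have dpair i l : differentiable (fun y => pairing ((g i l \o x) y) (v y)) y.
  have -> : (fun y => pairing ((g i l \o x) y) (v y)) =
      fun y => \sum_j v y 0 j * (g i l \o x) y j 0.
    by apply/funext => z; rewrite pairing_sum.
  apply: differentiable_sumP => j _; apply: differentiableM.
    exact: differentiable_entry.
  by apply: differentiable_entry; exact: dgx.
have dD : differentiable (fun y => 'D_(v y) f (x y)) y.
  apply: differentiable_mx => i l; exact: near_eq_differentiable (nE i l) (dpair i l).
apply/matrixP => i l; rewrite (derive_entry W i l dD) [RHS]mxE.
rewrite -(near_eq_derive W (nE i l)) (derive_pairing W (dgx i l) dv).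
congr (_ + _); last exact: esym (entryE i l _ _ Sx).
have dg := smooth_on_diff (sg i l) Sx.
rewrite (derive_chain W dx dg) -(derive_pairingl _ _ dg).
have dfv := smooth_on_diff (smooth_on_derive (v y) sf) Sx.
rewrite (derive_entry _ i l dfv); apply: near_eq_derive.
by apply: (nearU oS) Sx _ => z Sz; rewrite entryE.
Qed.

Lemma derive_row_mx (V : normedModType R) p q r (f : V -> 'M[R]_(p, q))
    (g : V -> 'M[R]_(p, r)) x w : differentiable f x -> differentiable g x ->
  'D_w (fun y => row_mx (f y) (g y)) x = row_mx ('D_w f x) ('D_w g x).
Proof.
move=> df dg.
have dr : differentiable (fun y => row_mx (f y) (g y)) x.
  apply: differentiable_mx => i j; case: (split_ordP j) => k ->.
    under [X in differentiable X _]eq_fun do rewrite row_mxEl.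
    exact: differentiable_entry.
  under [X in differentiable X _]eq_fun do rewrite row_mxEr.
  exact: differentiable_entry.
apply/matrixP => i j; rewrite (derive_entry w i j dr).
case: (split_ordP j) => k ->.
  rewrite row_mxEl (derive_entry w i k df); congr ('D_w _ x).
  by apply/funext => y; rewrite row_mxEl.
rewrite row_mxEr (derive_entry w i k dg); congr ('D_w _ x).
by apply/funext => y; rewrite row_mxEr.
Qed.

Lemma derive_lsub p q r (x w : 'M[R]_(p, q + r)) :
  'D_w (fun y => lsubmx y) x = lsubmx w.
Proof.
have d := @differentiable_lsubmx R p q r x.
apply/matrixP => i j; rewrite (derive_entry w i j d) mxE.
have -> : (fun y : 'M[R]_(p, q + r) => lsubmx y i j) = fun y => y i (lshift r j).
  by apply/funext => y; rewrite mxE.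
rewrite -(derive_entry w i (lshift r j)) ?derive_id //.
Qed.

Lemma derive_rsub p q r (x w : 'M[R]_(p, q + r)) :
  'D_w (fun y => rsubmx y) x = rsubmx w.
Proof.
have d := @differentiable_rsubmx R p q r x.
apply/matrixP => i j; rewrite (derive_entry w i j d) mxE.
have -> : (fun y : 'M[R]_(p, q + r) => rsubmx y i j) = fun y => y i (rshift q j).
  by apply/funext => y; rewrite mxE.
rewrite -(derive_entry w i (rshift q j)) ?derive_id //.
Qed.

Lemma derive_affine (V W : normedModType R) (f : V -> W) x w l :
  (forall h : R, f (h *: w + x) = f x + h *: l) -> 'D_w f x = l.
Proof.
move=> H; apply: cvg_lim => //.
have : (fun _ : R => l) @ 0^' --> l by apply: cvg_cst.
apply: cvg_trans; apply: near_eq_cvg; near=> h.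
have h0 : h != 0 by near: h; exact: nbhs_dnbhs_neq.
by rewrite /= H addrC addKr scalerA mulVf // scale1r.
Unshelve. all: by end_near. Qed.

End Directional.

(** * The manifold TM x R *)

Section TangentAtlas.
Context {R : realType}.

Lemma open_lsub (q r : nat) (U : set 'rV[R]_q) : open U ->
  open [set y : 'rV[R]_(q + r) | U (lsubmx y)].
Proof.
move=> oU; apply: (@open_comp _ _ (lsubmx : 'rV[R]_(q + r) -> 'rV[R]_q)) => //.
by move=> y _; exact: continuous_lsubmx.
Qed.

Lemma const_rsub1 (q : nat) (y : 'rV[R]_(q + 1)) :
  const_mx (rsubmx y 0 0) = rsubmx y.
Proof. by apply/rowP => i; rewrite mxE !ord1. Qed.

Section Line.
Context {T : Type} {m : nat}.
Implicit Types c : chart R T m.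

Lemma valid_line c : valid_chart c -> valid_chart (line_chart c).
Proof.
move=> [cK oc]; split.
  by move=> [p t] cp /=; rewrite row_mxKl row_mxKr mxE cK.
have -> : codom_chart (line_chart c) = [set y | codom_chart c (lsubmx y)].
  apply/seteqP; split=> [y [[p t] cp <-]|y [p cp py]] /=.
    by rewrite row_mxKl; exists p.
  exists (p, rsubmx y 0 0) => //=.
  by rewrite py const_rsub1 hsubmxK.
exact: open_lsub.
Qed.

Lemma overlap_line c c' : overlap (line_chart c) (line_chart c') =
  [set y | overlap c c' (lsubmx y)].
Proof.
apply/seteqP; split=> [y [[p t] cp <-]|y [p cp py]] /=.
  by rewrite row_mxKl; exists p.
exists (p, rsubmx y 0 0) => //=.
by rewrite py const_rsub1 hsubmxK.
Qed.

Lemma trans_line c c' : trans (line_chart c) (line_chart c') =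
  fun y => row_mx (trans c c' (lsubmx y)) (rsubmx y).
Proof. by apply/funext => y; rewrite /trans /= const_rsub1. Qed.

Lemma smooth_trans_line c c' : open (overlap c c') ->
  smooth_on (overlap c c') (trans c c') ->
  smooth_on (overlap (line_chart c) (line_chart c'))
    (trans (line_chart c) (line_chart c')).
Proof.
move=> oo st; have oO : open (overlap (line_chart c) (line_chart c')).
  by rewrite overlap_line; exact: open_lsub.
rewrite trans_line; apply: smooth_on_row_mx => //.
  refine (smooth_on_comp oO oo (f := lsubmx) _ _ st).
    by rewrite overlap_line.
  exact: smooth_on_lsub oO (smooth_on_id oO).
exact: smooth_on_rsub oO (smooth_on_id oO).
Qed.

Lemma compatible_line c c' : compatible c c' ->
  compatible (line_chart c) (line_chart c').
Proof.
move=> cc'; have c'c := compatible_sym cc'.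
have oo := open_overlap cc'; have oo' := open_overlap c'c.
apply: compatible_overlap.
- by rewrite overlap_line; exact: open_lsub.
- by rewrite overlap_line; exact: open_lsub.
- by apply: smooth_trans_line => //; exact: smooth_trans.
- by apply: smooth_trans_line => //; exact: smooth_trans.
Qed.

Lemma smooth_atlas_line (A : atlas R T m) : smooth_atlas A ->
  smooth_atlas (times_line A).
Proof.
move=> SA; split; first by move=> [p t]; exact: (cdom_pref SA p).
  by move=> i; apply: valid_line; exact: validC.
by move=> i j; apply: compatible_line; exact: compatC.
Qed.

End Line.

Section Tangent.
Context {T : Type} {m : nat} {A : atlas R T m}.
Hypothesis SA : smooth_atlas A.
Local Notation C := (charts A).
Local Notation TC i := (tangent_chart A (C i)).
Implicit Types (i j : chart_index A).

(** The preferred chart cancels by the cocycle rule, so fibre coordinates change by the derivative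
    of the transition map. *)
Lemma tcoord_tinv i j x v : overlap (C i) (C j) x ->
  tcoord A (C j) (cinv (C i) x) (tinv A (C i) x v) =
  'D_v (trans (C i) (C j)) x.
Proof.
move=> ox; have /(overlapP _ _ (validC SA i))[cx cj] := ox.
rewrite (tcoordE j) (tinvE (A := A)) -(trans_pref (A := A)) derive_trans //; try exact: (validC SA);
  try exact: (compatC SA); exact: (overlap_pref SA).
Qed.

Lemma codom_tangent i : codom_chart (TC i) =
  [set y | codom_chart (C i) (lsubmx y)].
Proof.
apply/seteqP; split=> [y [[p v] cp <-]|y cy] /=.
  by rewrite row_mxKl; exists p.
exists (cinv (TC i) y) => /=; first by have [] := codomP (validC SA i) cy.
rewrite (tinvK SA _ cy); have [_ ->] := codomP (validC SA i) cy.
by rewrite hsubmxK.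
Qed.

Lemma valid_tangent i : valid_chart (TC i).
Proof.
split.
  move=> [p v] /= cp; rewrite row_mxKl row_mxKr.
  by rewrite (coordK (validC SA i) cp) (tcoordK SA).
rewrite codom_tangent; apply: open_lsub; exact: (open_codom SA (i := i)).
Qed.

Lemma overlap_tangent i j : overlap (TC i) (TC j) =
  [set y | overlap (C i) (C j) (lsubmx y)].
Proof.
apply/seteqP; split=> y.
  move=> /(overlapP _ _ (valid_tangent i))[+ cj].
  rewrite codom_tangent => cy; apply/(overlapP _ _ (validC SA i)).
  by split.
move=> /(overlapP _ _ (validC SA i))[cy cj].
by apply/(overlapP _ _ (valid_tangent i)); rewrite codom_tangent.
Qed.

Lemma trans_tangent i j y : overlap (C i) (C j) (lsubmx y) ->
  trans (TC i) (TC j) y =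
  row_mx (trans (C i) (C j) (lsubmx y)) ('D_(rsubmx y) (trans (C i) (C j)) (lsubmx y)).
Proof. by move=> oy; rewrite -(tcoord_tinv _ oy). Qed.

Lemma compatible_tangent i j : compatible (TC i) (TC j).
Proof.
have oO i' j' : open (overlap (TC i') (TC j')).
  by rewrite overlap_tangent; apply: open_lsub; apply: open_overlap; exact: (compatC SA).
have st i' j' : smooth_on (overlap (TC i') (TC j')) (trans (TC i') (TC j')).
  have o := open_overlap (compatC SA i' j').
  have s := smooth_trans (compatC SA i' j').
  have sl := smooth_on_lsub (oO i' j') (smooth_on_id (oO i' j')).
  have sr := smooth_on_rsub (oO i' j') (smooth_on_id (oO i' j')).
  have US y : overlap (TC i') (TC j') y -> overlap (C i') (C j') (lsubmx y).
    by rewrite overlap_tangent.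
  refine (smooth_on_ext (oO i' j') (fun y oy => esym (trans_tangent (US y oy))) _).
  apply: smooth_on_row_mx => //.
    exact (smooth_on_comp (oO i' j') o US sl s).
  exact (smooth_on_dir (oO i' j') o US sl sr s).
exact: compatible_overlap (oO i j) (oO j i) (st i j) (st j i).
Qed.

Lemma smooth_atlas_tangent : smooth_atlas (tangent_atlas A).
Proof.
split; first by move=> [p v]; exact: (cdom_pref SA p).
  exact: valid_tangent.
exact: compatible_tangent.
Qed.

End Tangent.

Definition xpart m (y : 'rV[R]_(m + m + 1)) : 'rV[R]_m := lsubmx (lsubmx y).
Definition vpart m (y : 'rV[R]_(m + m + 1)) : 'rV[R]_m := rsubmx (lsubmx y).
Definition tpart m (y : 'rV[R]_(m + m + 1)) : R := rsubmx y 0 0.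
(** Serves both for points (x, v, t) and for tangent vectors (a, b, s) in the induced coordinates of
    TM x R. *)
Definition jet m (x v : 'rV[R]_m) (t : R) : 'rV[R]_(m + m + 1) :=
  row_mx (row_mx x v) (const_mx t).

Lemma xpart_jet m (x v : 'rV[R]_m) t : xpart (jet x v t) = x.
Proof. by rewrite /xpart /jet !row_mxKl. Qed.
Lemma vpart_jet m (x v : 'rV[R]_m) t : vpart (jet x v t) = v.
Proof. by rewrite /vpart /jet row_mxKl row_mxKr. Qed.
Lemma tpart_jet m (x v : 'rV[R]_m) t : tpart (jet x v t) = t.
Proof. by rewrite /tpart /jet row_mxKr mxE. Qed.
Lemma jetK m (y : 'rV[R]_(m + m + 1)) : jet (xpart y) (vpart y) (tpart y) = y.
Proof. by rewrite /jet hsubmxK const_rsub1 hsubmxK. Qed.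

Lemma xpartB m (y z : 'rV[R]_(m + m + 1)) : xpart (y - z) = xpart y - xpart z.
Proof. by rewrite /xpart !linearB. Qed.

Lemma jet_lin m k (x v x' v' : 'rV[R]_m) t t' :
  k *: jet x v t + jet x' v' t' = jet (k *: x + x') (k *: v + v') (k * t + t').
Proof.
rewrite /jet !scale_row_mx !add_row_mx; congr (row_mx (row_mx _ _) _).
by apply/rowP => i; rewrite !mxE.
Qed.

Section Parts.
Context {m : nat}.
Implicit Types y W : 'rV[R]_(m + m + 1).

Lemma xpart_diff y : differentiable (@xpart m) y.
Proof.
apply: (@differentiable_comp _ _ _ _ (@lsubmx R 1 (m + m) 1) (@lsubmx R 1 m m)).
  exact: differentiable_lsubmx.
exact: differentiable_lsubmx.
Qed.

Lemma vpart_diff y : differentiable (@vpart m) y.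
Proof.
apply: (@differentiable_comp _ _ _ _ (@lsubmx R 1 (m + m) 1) (@rsubmx R 1 m m)).
  exact: differentiable_lsubmx.
exact: differentiable_rsubmx.
Qed.

Lemma derive_xpart y W : 'D_W (@xpart m) y = xpart W.
Proof.
rewrite (derive_chain (f := @lsubmx R 1 (m + m) 1) (g := @lsubmx R 1 m m)).
- by rewrite derive_lsub derive_lsub.
- exact: differentiable_lsubmx.
- exact: differentiable_lsubmx.
Qed.

Lemma derive_vpart y W : 'D_W (@vpart m) y = vpart W.
Proof.
rewrite (derive_chain (f := @lsubmx R 1 (m + m) 1) (g := @rsubmx R 1 m m)).
- by rewrite derive_lsub derive_rsub.
- exact: differentiable_lsubmx.
- exact: differentiable_rsubmx.
Qed.

Lemma tpartE : @tpart m = fun z => z 0 (rshift (m + m) 0).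
Proof. by apply/funext => z; rewrite /tpart mxE. Qed.

Lemma derive_tpart y W : 'D_W (@tpart m) y = tpart W.
Proof.
have di : differentiable (fun z : 'rV[R]_(m + m + 1) => z) y by [].
by rewrite tpartE -(derive_entry W 0 (rshift (m + m) 0) di) derive_id.
Qed.

Lemma smooth_xpart (U : set 'rV[R]_(m + m + 1)) : open U -> smooth_on U (@xpart m).
Proof.
by move=> oU; do 2 apply: (smooth_on_lsub oU); exact: smooth_on_id.
Qed.

Lemma smooth_vpart (U : set 'rV[R]_(m + m + 1)) : open U -> smooth_on U (@vpart m).
Proof.
by move=> oU; apply: (smooth_on_rsub oU); apply: (smooth_on_lsub oU); exact: smooth_on_id.
Qed.

Lemma smooth_tpart (U : set 'rV[R]_(m + m + 1)) : open U -> smooth_on U (@tpart m).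
Proof.
move=> oU; have s := smooth_on_rsub oU (smooth_on_id oU).
exact: (proj1 (smooth_on_mx oU _) s 0 0).
Qed.

Lemma smooth_jet (V : normedModType R) (U : set V) (x v : V -> 'rV[R]_m) (t : V -> R) :
  open U -> smooth_on U x -> smooth_on U v -> smooth_on U t ->
  smooth_on U (fun z => jet (x z) (v z) (t z)).
Proof.
move=> oU sx sv st; apply: smooth_on_row_mx => //.
  exact: smooth_on_row_mx.
apply/(smooth_on_mx oU) => i j.
by refine (smooth_on_ext oU _ st) => y _; rewrite mxE.
Qed.

Lemma derive_jet (V : normedModType R) (x v : V -> 'rV[R]_m) (t : V -> R) (y w : V) :
  differentiable x y -> differentiable v y -> differentiable t y ->
  'D_w (fun z => jet (x z) (v z) (t z)) y = jet ('D_w x y) ('D_w v y) ('D_w t y).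
Proof.
move=> dx dv dt.
have dxv : differentiable (fun z => row_mx (x z) (v z)) y.
  apply: differentiable_mx => i j; case: (split_ordP j) => k ->.
    under [X in differentiable X _]eq_fun do rewrite row_mxEl.
    exact: differentiable_entry.
  under [X in differentiable X _]eq_fun do rewrite row_mxEr.
  exact: differentiable_entry.
have dc : differentiable (fun z => const_mx (t z) : 'rV[R]_1) y.
  apply: differentiable_mx => i j.
  by under [X in differentiable X _]eq_fun do rewrite mxE.
rewrite /jet (derive_row_mx w dxv dc) (derive_row_mx w dx dv); congr row_mx.
apply/rowP => i; rewrite (derive_entry w 0 i dc) mxE; congr ('D_w _ y).
by apply/funext => z; rewrite mxE.
Qed.

End Parts.
End TangentAtlas.

(** * The contact form eta_bar *)

Section EtaBar.
Context {R : realType} {T : Type} {m : nat} {A : atlas R T m}.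
Hypothesis SA : smooth_atlas A.
Local Notation C := (charts A).
Local Notation B := (times_line (tangent_atlas A)).
Let CB (i : chart_index A) : chart R (T * 'rV[R]_m * R) (m + m + 1) := charts B i.
Implicit Types (i j : chart_index A) (p : T).

Lemma smooth_atlas_B : smooth_atlas B.
Proof. exact: smooth_atlas_line (smooth_atlas_tangent SA). Qed.
Local Notation SB := smooth_atlas_B.

Lemma overlapB i j y : overlap (CB i) (CB j) y <-> overlap (C i) (C j) (xpart y).
Proof.
rewrite /CB -[charts B i]/(line_chart (tangent_chart A (C i))).
rewrite -[charts B j]/(line_chart (tangent_chart A (C j))).
by rewrite overlap_line /= (overlap_tangent SA).
Qed.

Lemma codomB i y : codom_chart (CB i) y <-> codom_chart (C i) (xpart y).
Proof. by rewrite -!overlap_self; exact: overlapB. Qed.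

Lemma transB i j y : overlap (C i) (C j) (xpart y) -> trans (CB i) (CB j) y =
  jet (trans (C i) (C j) (xpart y)) ('D_(vpart y) (trans (C i) (C j)) (xpart y))
    (tpart y).
Proof.
move=> oy; rewrite /CB -[charts B i]/(line_chart (tangent_chart A (C i))).
rewrite -[charts B j]/(line_chart (tangent_chart A (C j))) trans_line.
by rewrite (trans_tangent SA oy) /jet /tpart const_rsub1.
Qed.

(** The second-order term appears because the new fibre coordinate, the derivative of the transition
    along v, also depends on the base point. *)
Lemma derive_transB i j y a b s : overlap (C i) (C j) (xpart y) ->
  'D_(jet a b s) (trans (CB i) (CB j)) y =
  jet ('D_a (trans (C i) (C j)) (xpart y))
   ('D_a (fun z => 'D_(vpart y) (trans (C i) (C j)) z) (xpart y) +
    'D_b (trans (C i) (C j)) (xpart y)) s.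
Proof.
move=> oy; set phi := trans (C i) (C j).
have oo := open_overlap (compatC SA i j).
have sphi : smooth_on (overlap (C i) (C j)) phi := smooth_trans (compatC SA i j).
have oO : open (overlap (CB i) (CB j)) := open_overlap (compatC SB i j).
have oyB : overlap (CB i) (CB j) y by apply/overlapB.
have nE : \forall z \near y, trans (CB i) (CB j) z =
    jet ((phi \o @xpart R m) z) ('D_(vpart z) phi (xpart z)) (tpart z).
  by apply: (nearU oO) oyB _ => z /overlapB oz; rewrite transB.
have US z : overlap (CB i) (CB j) z -> overlap (C i) (C j) (xpart z).
  by move/overlapB.
have sx := smooth_xpart oO; have sv := smooth_vpart oO; have st := smooth_tpart oO.
have s2 := smooth_on_dir oO oo US sx sv sphi.
have dphi := smooth_on_diff sphi oy.
rewrite (near_eq_derive _ nE) derive_jet.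
- rewrite (derive_chain _ (xpart_diff y) dphi) derive_xpart xpart_jet.
  rewrite (derive_dir _ oo oy (xpart_diff y) (vpart_diff y) sphi).
  rewrite derive_xpart derive_vpart xpart_jet vpart_jet; congr jet.
  exact: etrans (derive_tpart _ _) (tpart_jet _ _ _).
- by apply: differentiable_comp => //; exact: xpart_diff.
- exact: smooth_on_diff s2 oyB.
- exact: smooth_on_diff st oyB.
Qed.

Variable eta : form1 R T m.
Hypothesis seta : smooth_form A eta.
Local Notation EB := (eta_bar A eta).
Local Notation ec i := (local_form A eta (C i)).

Lemma pairing_eta_bar p v t a b s :
  pairing (EB (p, v, t)) (jet a b s) =
  pairing ('D_v (local_form A eta (pchart A p)) (pcoord A p)) a
  + pairing (eta p) b + t * pairing (eta p) a.
Proof.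
have gen (e e1 : 'cV[R]_m) : pairing (col_mx (col_mx e e1) (0 : 'cV[R]_1)
    + t *: col_mx (col_mx e1 0) (0 : 'cV[R]_1)) (jet a b s)
    = pairing e a + pairing e1 b + t * pairing e1 a.
  by rewrite pairingDl pairingZl /jet !pairing_colrow !pairing0l !addr0.
exact: gen.
Qed.

(** The complete lift is defined through preferred charts only; this shows that its coordinate
    formula holds in every induced chart. *)
Lemma pairing_local_B i y a b s : codom_chart (C i) (xpart y) ->
  pairing (local_form B EB (CB i) y) (jet a b s) =
  pairing ('D_(vpart y) (ec i) (xpart y)) a + pairing (ec i (xpart y)) b
  + tpart y * pairing (ec i (xpart y)) a.
Proof.
move=> cx; have cy : codom_chart (CB i) y by apply/codomB.
set x := xpart y in cx *; set v := vpart y; set t := tpart y.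
set p := cinv (C i) x; set j := pref A p; set phi := trans (C i) (C j).
have ox : overlap (C i) (C j) x by exact: (overlap_pref SA).
have oo := open_overlap (compatC SA i j).
have sphi : smooth_on (overlap (C i) (C j)) phi := smooth_trans (compatC SA i j).
have dphi := smooth_on_diff sphi ox.
have phix : phi x = pcoord A p by [].
have dj : differentiable (ec j) (phi x).
  by rewrite phix; apply: (local_form_diff seta); exact: (codom_pcoord SA).
have di : differentiable (ec i) x by exact: (local_form_diff seta).
have E1 : pairing (local_form B EB (CB i) y) (jet a b s) =
    pairing (EB (p, tinv A (C i) x v, t)) (tinv B (CB i) y (jet a b s)).
  exact: (pairing_local_form SB EB (i := i)).
have E2 : tinv B (CB i) y (jet a b s) = jet ('D_a phi x)
    ('D_a (fun z => 'D_v phi z) x + 'D_b phi x) s.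
  exact: (derive_transB (i := i) (j := j)).
have E3 u : pairing (ec i x) u = pairing (eta p) ('D_u phi x).
  rewrite (local_form_trans SA eta ox) (pairing_pull _ _ dphi).
  by rewrite -/phi phix (local_form_pref SA).
have E4 : pairing ('D_v (ec i) x) a =
   pairing ('D_('D_v phi x) (ec j) (phi x)) ('D_a phi x) +
   pairing (eta p) ('D_v (fun z => 'D_a phi z) x).
  have -> : eta p = ec j (phi x) by rewrite phix; exact: esym (local_form_pref SA eta p).
  apply: etrans (esym (derive_pairingl a v di)) _.
  apply: etrans (derive_pairing_pull v a oo ox sphi dj).
  apply: near_eq_derive; apply: (nearU oo) ox _ => z oz.
  by rewrite (local_form_trans SA eta oz).
apply: etrans E1 _; apply: etrans (congr1 (pairing _) E2) _.
apply: etrans (pairing_eta_bar _ _ _ _ _ _) _.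
(* [Q] is the second derivative of [phi] produced by differentiating the pullback of eta, [Q'] the
   one in the transition map of TM; they differ in the order of differentiation. *)
have aux (k P Q Q' S U V X Y Z : R) : X = P + Q -> Y = S -> Z = U ->
    Q' = Q -> V = Q' + S -> P + V + k * U = X + Y + k * Z.
  by move=> -> -> -> -> ->; rewrite addrA.
refine (aux _ _ _ _ _ _ _ _ _ _ E4 (E3 b) (E3 a) _ (pairingDr _ _ _)).
exact: congr1 (derive_comm_mx a v oo ox sphi).
Qed.

Definition omega i (y : 'rV[R]_(m + m + 1)) : 'cV[R]_(m + m + 1) :=
  col_mx (col_mx ('D_(vpart y) (ec i) (xpart y) + tpart y *: ec i (xpart y))
    (ec i (xpart y))) 0.

Lemma local_B i y : codom_chart (C i) (xpart y) ->
  local_form B EB (CB i) y = omega i y.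
Proof.
move=> cx; apply: pairing_inj => W; rewrite -(jetK W) pairing_local_B //.
have gen (e e1 : 'cV[R]_m) k a b s : pairing e a + pairing e1 b + k * pairing e1 a =
    pairing (col_mx (col_mx (e + k *: e1) e1) (0 : 'cV[R]_1)) (jet a b s).
  by rewrite /jet !pairing_colrow pairing0l addr0 pairingDl pairingZl addrAC.
exact: gen.
Qed.

Lemma smooth_eta_bar : smooth_form B EB.
Proof.
move=> i; have oC : open (codom_chart (CB i)) := open_codom SB (i := i).
have oc := open_codom SA (i := i).
have US y : codom_chart (CB i) y -> codom_chart (C i) (xpart y) by move/codomB.
refine (smooth_on_ext oC (fun y cy => esym (local_B (US y cy))) _).
have sx := smooth_xpart oC; have sv := smooth_vpart oC; have st := smooth_tpart oC.
have s1 := smooth_on_comp oC oc US sx (@seta i).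
have s2 := smooth_on_dir oC oc US sx sv (@seta i).
have s3 : smooth_on (codom_chart (CB i)) (fun y => tpart y *: ec i (xpart y)).
  apply/(smooth_on_mx oC) => k l.
  refine (smooth_on_ext oC (f := fun y => tpart y * ec i (xpart y) k l) _ _).
    by move=> y _; rewrite [RHS]mxE.
  exact (smooth_onM oC st (proj1 (smooth_on_mx oC _) s1 k l)).
have s4 := smooth_onD oC s2 s3.
apply/(smooth_on_mx oC) => k l; case: (split_ordP k) => k' ->; last first.
  refine (smooth_on_ext oC _ (smooth_on_cst (0 : R))) => y _.
  by rewrite /omega col_mxEd mxE.
case: (split_ordP k') => k'' ->.
  refine (smooth_on_ext oC _ (proj1 (smooth_on_mx oC _) s4 k'' l)) => y _.
  by rewrite /omega !col_mxEu.
refine (smooth_on_ext oC _ (proj1 (smooth_on_mx oC _) s1 k'' l)) => y _.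
by rewrite /omega col_mxEu col_mxEd.
Qed.

(** Along the vertical vector (0, b, s) the base point is fixed and eta_bar is affine in (v, t),
    while eta_bar(0, b, s) = eta(b) depends on the base point only. So no second derivatives of eta
    occur. *)
Lemma dform_eta_bar p v t b s a' b' s' :
  dform B EB (p, v, t) (jet 0 b s) (jet a' b' s') =
  dform A eta p b a' + s * pairing (eta p) a'.
Proof.
set i := pref A p; set x := pcoord A p.
have cx : codom_chart (C i) x by exact: (codom_pcoord SA).
have de : differentiable (ec i) x by exact: (local_form_diff seta).
have pB : pcoord B (p, v, t) = jet x v t.
  rewrite -[pcoord _ _]/(jet x (tcoord A (pchart A p) p v) t).
  by rewrite (tcoord_pref SA).
rewrite /dform pB -[pchart B _]/(CB i) -[pchart A p]/(C i) -/x.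
have E1 : 'D_(jet 0 b s) (fun y => pairing (local_form B EB (CB i) y) (jet a' b' s'))
    (jet x v t) = pairing ('D_b (ec i) x) a' + s * pairing (eta p) a'.
  apply: derive_affine => h; rewrite jet_lin scaler0 add0r.
  have L w r : pairing (local_form B EB (CB i) (jet x w r)) (jet a' b' s') =
      pairing ('D_w (ec i) x) a' + pairing (ec i x) b' + r * pairing (ec i x) a'.
    have := @pairing_local_B i (jet x w r) a' b' s'.
    by rewrite xpart_jet vpart_jet tpart_jet; apply.
  apply: etrans (L _ _) _; rewrite (L v t).
  rewrite (derive_addv _ _ de) (derive_scalev _ _ de) -(local_form_pref SA eta p).
  have aux (k r r' X Y Z P e : R) : P = k * X + Y ->
     P + Z + (k * r + r') * e = Y + Z + r' * e + k * (X + r * e).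
    by move=> ->; ring.
  by apply: aux; rewrite pairingDl pairingZl.
have oC : open (codom_chart (CB i)) := open_codom SB (i := i).
have cy : codom_chart (CB i) (jet x v t) by apply/codomB; rewrite xpart_jet.
have nE : \forall y \near jet x v t, pairing (local_form B EB (CB i) y) (jet 0 b s) =
   ((fun z => pairing (ec i z) b) \o @xpart R m) y.
  apply: (nearU oC) cy _ => y /codomB cy'.
  by rewrite pairing_local_B // !pairing0r mulr0 add0r addr0.
have de2 : differentiable (fun z => pairing (ec i z) b) (xpart (jet x v t)).
  rewrite xpart_jet.
  have oc := open_codom SA (i := i).
  exact: smooth_on_diff (smooth_on_pairing oc (@seta i) (smooth_on_cst b)) cx.
have E2 : 'D_(jet a' b' s') (fun y => pairing (local_form B EB (CB i) y) (jet 0 b s))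
    (jet x v t) = 'D_a' (fun z => pairing (ec i z) b) x.
  rewrite (near_eq_derive _ nE) (derive_chain _ (xpart_diff _) de2).
  by rewrite derive_xpart !xpart_jet.
have E3 := derive_pairingl a' b de.
have aux (P Q U V k : R) : P = V + k -> Q = U -> P - Q = (V - U) + k.
  by move=> -> ->; ring.
apply: aux; last exact: E2.
by rewrite E3; exact: E1.
Qed.

Hypothesis om : odd m.
Hypothesis nd : forall p, nondegenerate (eta p) (dform A eta p).

Lemma odd_B : odd (m + m + 1).
Proof. by rewrite addn1 /= addnn odd_double. Qed.

(** Evaluation at the Reeb vector isolates s; nondegeneracy of eta then gives b = 0. This settles
    the vertical case both for nondegeneracy of eta_bar and for the Legendrian condition. *)
Lemma vertical_kernel p b s :
  (forall a, dform A eta p b a + s * pairing (eta p) a = 0) ->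
  pairing (eta p) b = 0 -> b = 0 /\ s = 0.
Proof.
move=> H eb; have [h1 h2] := reebP SA seta om nd p.
have [lb ab] := skew_dform SA seta p.
have s0 : s = 0 by have := H (reeb A eta p); rewrite ab h2 oppr0 add0r h1 mulr1.
split => //; apply: (nd (p := p)) => // u.
by have := H u; rewrite s0 mul0r addr0.
Qed.

(** Testing z against (0, 0, 1) gives eta(a) = 0 and against (0, b', 0) gives d eta(b', a) = 0, so
    the base part a is 0. What is left of z is vertical. *)
Lemma nondegenerate_eta_bar q : nondegenerate (EB q) (dform B EB q).
Proof.
case: q => -[p v] t z; rewrite -(jetK z).
set a := xpart z; set b := vpart z; set s := tpart z => ez dz.
have [lb ab] := skew_dform SA seta p.
have [lB aB] := skew_dform SB smooth_eta_bar (p, v, t).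
have H b' s' : dform A eta p b' a + s' * pairing (eta p) a = 0.
  by rewrite -(dform_eta_bar p v t b' s' a b s) aB dz oppr0.
have d0 u : dform A eta p 0 u = 0.
  by have := lb (-1) 0 0 u; rewrite scaler0 addr0 mulN1r addNr.
have ea : pairing (eta p) a = 0 by have := H 0 1; rewrite d0 add0r mul1r.
have a0 : a = 0.
  apply: (nd (p := p)) => // u; have := H u 0.
  by rewrite mul0r addr0 ab => /eqP; rewrite oppr_eq0 => /eqP.
move: ez dz; rewrite a0 pairing_eta_bar !pairing0r mulr0 add0r addr0 => eb dz.
have H2 a' : dform A eta p b a' + s * pairing (eta p) a' = 0.
  by rewrite -(dform_eta_bar p v t b s a' 0 0) dz.
have [-> ->] := vertical_kernel H2 eb.
by rewrite /jet (_ : const_mx 0 = 0) ?row_mx0 //; apply/matrixP => ? ?; rewrite !mxE.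
Qed.

End EtaBar.

(** * The image of X_bar *)

Section XBar.
Context {R : realType} {T : Type} {m : nat} (A : atlas R T m).
Hypothesis SA : smooth_atlas A.
Local Notation C := (charts A).
Local Notation B := (times_line (tangent_atlas A)).
Let CB (i : chart_index A) : chart R (T * 'rV[R]_m * R) (m + m + 1) := charts B i.
Let SB : smooth_atlas B := smooth_atlas_B SA.
Variable eta : form1 R T m.
Hypothesis seta : smooth_form A eta.
Hypothesis om : odd m.
Hypothesis nd : forall p, nondegenerate (eta p) (dform A eta p).
Variable X : vfield R T m.
Hypothesis sX : smooth_vf A X.
Implicit Types (i j : chart_index A) (p : T).
Local Notation EB := (eta_bar A eta).
Local Notation ec i := (local_form A eta (C i)).
Local Notation Xc i := (local_vf A X (C i)).

Definition etaX p : R := pairing (eta p) (X p).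
Definition fX p : R := - pairing (dfun A etaX p) (reeb A eta p).
(* X_bar in the chart i of M and the induced chart of TM x R *)
Definition FX i (x : 'rV[R]_m) : 'rV[R]_(m + m + 1) :=
  jet x (Xc i x) ((fX \o cinv (C i)) x).
(* (L_X eta + fX eta)(v), by Cartan's formula *)
Definition lie p (v : 'rV[R]_m) : R :=
  dform A eta p (X p) v + pairing (dfun A etaX p) v + fX p * pairing (eta p) v.

Lemma smooth_etaX : smooth_fun A etaX.
Proof. exact (smooth_pairing SA seta sX). Qed.

Lemma smooth_fX : smooth_fun A fX.
Proof.
move=> i; have s := smooth_dfun SA smooth_etaX (smooth_reeb SA seta om nd).
exact (smooth_onN (open_codom SA (i := i)) (s i)).
Qed.

Lemma smooth_FX i : smooth_on (codom_chart (C i)) (FX i).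
Proof.
have oC := open_codom SA (i := i).
exact (smooth_jet oC (smooth_on_id oC) (@sX i) (@smooth_fX i)).
Qed.

Lemma derive_FX i x a : codom_chart (C i) x ->
  'D_a (FX i) x = jet a ('D_a (Xc i) x) ('D_a (fX \o cinv (C i)) x).
Proof.
move=> cx; have dX := smooth_on_diff (@sX i) cx.
have df := smooth_on_diff (@smooth_fX i) cx.
have did : differentiable (fun z : 'rV[R]_m => z) x by [].
apply: etrans (derive_jet a did dX df) _.
by rewrite derive_id.
Qed.

Lemma coord_X_bar i p : cdom (C i) p ->
  coord (CB i) (X_bar A eta X p) = FX i (coord (C i) p).
Proof.
by move=> cp; rewrite /FX /local_vf /= (coordK (validC SA i) cp).
Qed.

Lemma cinv_FX i x : codom_chart (C i) x -> cinv (CB i) (FX i x) =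
  X_bar A eta X (cinv (C i) x).
Proof.
move=> cx; have [cp E] := codomP (validC SA i) cx.
rewrite -{1}E -coord_X_bar //; apply: coordK; first exact: (validC SB i).
exact: cp.
Qed.

Lemma pairing_FX i x a : codom_chart (C i) x ->
  pairing (local_form B EB (CB i) (FX i x)) ('D_a (FX i) x) =
  lie (cinv (C i) x) (tinv A (C i) x a).
Proof.
move=> cx; have [cp E] := codomP (validC SA i) cx.
have dX := smooth_on_diff (@sX i) cx.
have de : differentiable (ec i) x := local_form_diff seta cx.
rewrite (derive_FX a cx).
have cF : codom_chart (C i) (xpart (FX i x)) by rewrite xpart_jet.
have := pairing_local_B SA seta a ('D_a (Xc i) x) ('D_a (fX \o cinv (C i)) x) cF.
rewrite /FX xpart_jet vpart_jet tpart_jet => H; apply: etrans H _.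
have E1 := dform_chart SA seta (X (cinv (C i) x)) (tinv A (C i) x a) cp.
rewrite (tinvK SA a cx) E -/(local_vf A X (C i) x) in E1.
have E2 := dfun_chart SA smooth_etaX (tinv A (C i) x a) cp.
rewrite (tinvK SA a cx) E in E2.
have E3 : 'D_a (etaX \o cinv (C i)) x =
    pairing ('D_a (ec i) x) (Xc i x) + pairing (ec i x) ('D_a (Xc i) x).
  apply: etrans _ (derive_pairing a de dX); apply: near_eq_derive.
  apply: (nearU (open_codom SA (i := i))) cx _ => z cz.
  exact (pairing_local SA eta X cz).
have E4 := pairing_local_form SA eta a cx.
rewrite /lie -E4.
(* Here P = (D_X eta)(a), Q = eta(D_a X) and S = (D_a eta)(X): then P - S is d eta(X, a), and S + Q
   is d(eta(X))(a). *)
have aux (P Q S Y Z U V : R) : Y = P - S -> Z = U -> U = S + Q ->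
  P + Q + V = Y + Z + V by move=> -> -> ->; ring.
exact: aux E1 E2 E3.
Qed.

Lemma dfun_opp p (f : T -> R) (g : T -> R) : smooth_fun A f -> (forall p, g p = - f p) ->
  dfun A g p = - dfun A f p.
Proof.
move=> sf gf; apply/matrixP => k l; rewrite !mxE.
have -> : g \o cinv (pchart A p) = - (f \o cinv (pchart A p)).
  by apply/funext => x /=; rewrite gf.
rewrite deriveN //; apply: diff_derivable.
exact: smooth_on_diff (@sf (pref A p)) (codom_pcoord SA p).
Qed.

Lemma hamiltonian_lie :
  (exists H : T -> R, smooth_fun A H /\ X = hamiltonian_vf A eta H) <->
  (forall p v, lie p v = 0).
Proof.
have key (H : T -> R) p : (forall p, H p = - etaX p) ->
    X p = hamiltonian_vf A eta H p <-> forall v, lie p v = 0.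
  move=> HE; have dH := dfun_opp p smooth_etaX HE.
  have flatX v : pairing (flat A eta p (X p)) v =
      dform A eta p (X p) v + etaX p * pairing (eta p) v.
    by rewrite (flatE SA seta).
  (* With H = - eta(X) one has dH(R) = [fX p], so the coefficient R(H) + H becomes
     [fX p - etaX p]. *)
  have rhs v : pairing (dfun A H p - (pairing (dfun A H p) (reeb A eta p) + H p) *: eta p) v
      = - pairing (dfun A etaX p) v - (fX p - etaX p) * pairing (eta p) v.
    by rewrite pairingBl pairingZl dH -scaleN1r !pairingZl HE !mulN1r.
  have flatS := flat_sharp SA seta om nd.
  split=> [XE v|L].
    have fe := etrans (congr1 (flat A eta p) XE) (flatS p _).
    have := flatX v; rewrite fe rhs /lie => E.
    have aux (a b c d e : R) : - a - (b - c) * e = d + c * e -> d + a + b * e = 0.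
      by move=> H1; have -> : d = - a - (b - c) * e - c * e; [rewrite H1; ring|ring].
    exact: aux E.
  apply/esym/(sharpE SA seta om nd); apply: pairing_inj => v.
  rewrite rhs flatX; have := L v; rewrite /lie => E.
  have aux (a b c d e : R) : d + a + b * e = 0 -> d + c * e = - a - (b - c) * e.
    by move=> H1; apply/eqP; rewrite -subr_eq0 -H1; apply/eqP; ring.
  exact: aux E.
split=> [[H [sH XE]] p v|L].
  apply: (key H p _).1; last by rewrite -XE.
  move=> q; have [h1 h2] := reebP SA seta om nd q.
  have [lb ab] := skew_dform SA seta q.
  have := flatE SA seta q (X q) (reeb A eta q).
  rewrite {1}XE /hamiltonian_vf (flat_sharp SA seta om nd) pairingBl pairingZl.
  rewrite h1 !mulr1 ab h2 oppr0 add0r => E.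
  by rewrite /etaX -E opprB addrAC subrr add0r.
exists (fun p => - etaX p); split.
  by move=> i; exact (smooth_onN (open_codom SA (i := i)) (@smooth_etaX i)).
by apply/funext => p; apply/(key _ _ (fun p => erefl)).
Qed.

Local Notation N := (range (X_bar A eta X)).

(** In the chart the image is the graph of [FX]. A curve in it is [FX] of its base projection, so
    its velocity is a derivative of [FX]; conversely straight lines of the base lift to curves in
    the image. *)
Lemma tangent_space_X_bar p : tangent_space B N (X_bar A eta X p) =
  [set 'D_a (FX (pref A p)) (pcoord A p) | a in setT].
Proof.
set i := pref A p; set x0 := pcoord A p.
have cx0 : codom_chart (C i) x0 by exact: codom_pcoord SA p.
have oC := open_codom SA (i := i).
have dF := smooth_on_diff (@smooth_FX i) cx0.
have ob (e : R) : open (ball (0 : R) e).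
  by rewrite -ball_normE; exact: ball_open.
apply/seteqP; split=> [v [g [e [e0 g0 gN sg <-]]]|_ [a _ <-]].
  set G := coord (pchart B (X_bar A eta X p)) \o g in sg *.
  have GE s : ball 0 e s -> codom_chart (C i) (xpart (G s)) /\
      G s = FX i (xpart (G s)).
    move=> /gN[[q _ qE] cq].
    have cq' : cdom (C i) q by move: cq; rewrite -qE.
    have GsE : G s = FX i (coord (C i) q).
      by rewrite -coord_X_bar //= /G /= -qE.
    by rewrite GsE xpart_jet; split => //; exists q.
  have b0 : ball (0 : R) e 0 by exact: ballxx.
  have dG := smooth_on_diff sg b0.
  have x0E : xpart (G 0) = x0.
    have -> : G 0 = coord (CB i) (X_bar A eta X p) by exact: congr1 g0.
    by rewrite coord_X_bar ?xpart_jet //; exact: (cdom_pref SA).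
  have dx : differentiable (@xpart R m \o G) 0.
    by apply: differentiable_comp => //; exact: xpart_diff.
  have xE : (@xpart R m \o G) 0 = x0 := x0E.
  have dF' : differentiable (FX i) ((@xpart R m \o G) 0) by rewrite xE.
  have E := derive_chain (1 : R) dx dF'.
  exists ('D_1 (@xpart R m \o G) 0); first by [].
  rewrite xE in E; apply: etrans (esym E) _; apply: etrans _ (esym (derive1E _ _)).
  apply: esym; apply: near_eq_derive; apply: (nearU (ob e)) b0 _ => s bs.
  by have [_ {1}->] := GE s bs.
(* The line through the base point with velocity a; as the codomain of the chart is open, it stays
   inside for small s. *)
pose l (s : R) : 'rV[R]_m := s *: a + x0.
have l0 : l 0 = x0 by rewrite /l scale0r add0r.
have sl (U : set R) : open U -> smooth_on U l.
  move=> oU; apply: smooth_onD => //; last exact: smooth_on_cst.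
  apply/(smooth_on_mx oU) => k k'.
  refine (smooth_on_ext oU _ (smooth_onM oU (smooth_on_id oU) (smooth_on_cst (a k k')))).
  by move=> s _; rewrite mxE.
have dl : differentiable l 0.
  by apply: smooth_on_diff (sl setT _) _ => //; exact: openT.
have Dl : 'D_1 l 0 = a.
  by apply: derive_affine => h; rewrite /l scale0r add0r addr0 [h *: 1]mulr1 addrC.
have [e e0 He] : exists2 e : R, 0 < e & forall s, ball 0 e s -> codom_chart (C i) (l s).
  have : \forall s \near (0 : R), codom_chart (C i) (l s).
    by apply: (differentiable_continuous dl); rewrite l0; exact: open_nbhs_nbhs.
  by move=> /nbhs_ballP[e /= e0 H]; exists e.
have gE s : ball 0 e s -> coord (CB i) (X_bar A eta X (cinv (C i) (l s))) = FX i (l s).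
  move=> /He cl; have [cp E] := codomP (validC SA i) cl.
  by rewrite -[in RHS]E; exact: coord_X_bar.
exists (fun s => X_bar A eta X (cinv (C i) (l s))), e; split.
- exact: e0.
- by rewrite l0 /x0 /i (cinv_pcoord SA).
- move=> s /He cl; have [cp E] := codomP (validC SA i) cl.
  by split; [exists (cinv (C i) (l s))|exact: cp].
- have H := smooth_on_comp (ob e) oC He (sl _ (ob e)) (@smooth_FX i).
  by refine (smooth_on_ext (ob e) _ H) => s bs; exact: esym (gE s bs).
- apply: etrans (derive1E _ _) _.
  have dF0 : differentiable (FX i) (l 0) by rewrite l0.
  have E := derive_chain (1 : R) dl dF0; rewrite Dl l0 in E.
  apply: etrans _ E; apply: near_eq_derive.
  by apply: (nearU (ob e)) (ballxx _ e0) _ => s bs; exact: gE.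
Qed.

End XBar.

(** * Isotropy and the Legendrian condition *)

Section Legendrian.
Context {R : realType} {T : Type} {m : nat} (A : atlas R T m).
Hypothesis SA : smooth_atlas A.
Local Notation C := (charts A).
Local Notation B := (times_line (tangent_atlas A)).
Let CB (i : chart_index A) : chart R (T * 'rV[R]_m * R) (m + m + 1) := charts B i.
Let SB : smooth_atlas B := smooth_atlas_B SA.
Variable eta : form1 R T m.
Hypothesis seta : smooth_form A eta.
Hypothesis om : odd m.
Hypothesis nd : forall p, nondegenerate (eta p) (dform A eta p).
Variable X : vfield R T m.
Hypothesis sX : smooth_vf A X.
Implicit Types (i j : chart_index A) (p : T).
Local Notation EB := (eta_bar A eta).
Local Notation XB := (X_bar A eta X).
Local Notation F p := (FX (A := A) eta X (pref A p)).
Let sEB : smooth_form B EB := smooth_eta_bar SA seta.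
Let ndB q : nondegenerate (EB q) (dform B EB q) := nondegenerate_eta_bar SA seta om nd (q := q).
Let omB : odd (m + m + 1) := odd_B.

Lemma pcoord_X_bar p : pcoord B (XB p) = F p (pcoord A p).
Proof. exact (coord_X_bar SA eta X (cdom_pref SA p)). Qed.

Lemma pairing_tangent p a :
  pairing (EB (XB p)) ('D_a (F p) (pcoord A p)) = lie A eta X p a.
Proof.
have := pairing_FX SA seta om nd sX a (codom_pcoord SA p).
rewrite (cinv_pcoord SA) (tinv_pref SA) => <-.
by rewrite -(local_form_pref SB EB (XB p)) pcoord_X_bar.
Qed.

(** Pairing flat(sharp a) with the Reeb vector shows that the form takes the value a(R) on sharp a,
    which is exactly what the Reeb correction subtracts. *)
Lemma pairing_sharp_Lambda q a : pairing (EB q) (sharp_Lambda B EB q a) = 0.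
Proof.
have [h1 h2] := reebP SB sEB omB ndB q.
have [lb ab] := skew_dform SB sEB q.
rewrite /sharp_Lambda pairingBr pairingZr h1 mulr1.
have := flatE SB sEB q (sharp B EB q a) (reeb B EB q).
rewrite (flat_sharp SB sEB omB ndB) h1 mulr1 ab h2 oppr0 add0r => ->.
by rewrite subrr.
Qed.

Lemma tangent_perp_lie :
  (forall q, range XB q -> tangent_space B (range XB) q =
     perp_Lambda B EB q (tangent_space B (range XB) q)) ->
  forall p a, lie A eta X p a = 0.
Proof.
move=> H p a; rewrite -pairing_tangent.
have TW : tangent_space B (range XB) (XB p) ('D_a (F p) (pcoord A p)).
  by rewrite (tangent_space_X_bar SA seta om nd sX); exists a.
rewrite H in TW; last by exists p.
by case: TW => b _ <-; exact: pairing_sharp_Lambda.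
Qed.

Section Isotropic.
Hypothesis L : forall p a, lie A eta X p a = 0.

(** The pullback of eta_bar along [FX] vanishes in a whole neighbourhood of the base point, hence so
    does its exterior derivative there. *)
Lemma dform_tangent p a b : dform B EB (XB p)
  ('D_a (F p) (pcoord A p)) ('D_b (F p) (pcoord A p)) = 0.
Proof.
set i := pref A p; set x0 := pcoord A p.
have cx0 : codom_chart (C i) x0 := codom_pcoord SA p.
have oC := open_codom SA (i := i).
have sF : smooth_on (codom_chart (C i)) (F p) := smooth_FX SA seta om nd sX (i := i).
have pE : pcoord B (XB p) = F p x0 := pcoord_X_bar p.
have dw : differentiable (local_form B EB (CB i)) (F p x0).
  rewrite -pE; exact: (local_form_diff sEB (codom_pcoord SB (XB p))).
have nE : \forall y \near x0, (fun=> (0 : 'cV[R]_m)) y =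
    pull_form (F p) (local_form B EB (CB i)) y.
  apply: (nearU oC) cx0 _ => y cy; apply: pairing_inj => u.
  rewrite (pairing_pull _ _ (smooth_on_diff sF cy)) pairing0l.
  by have := pairing_FX SA seta om nd sX u cy; rewrite L => ->.
have dp : differentiable (pull_form (F p) (local_form B EB (CB i))) x0.
  apply: near_eq_differentiable nE _; exact: differentiable_cst.
have E := ext_d_pull a b oC cx0 sF dw dp.
apply: etrans (dformE SB sEB (XB p) _ _) _; rewrite pE.
apply: etrans (esym E) _; rewrite -(ext_d_near a b nE) /ext_d !derive_cst.
by rewrite !pairing0l subrr.
Qed.

Lemma lie_tangent_perp q : range XB q -> tangent_space B (range XB) q =
  perp_Lambda B EB q (tangent_space B (range XB) q).
Proof.
move=> [p _ <-]; rewrite (tangent_space_X_bar SA seta om nd sX).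
set x0 := pcoord A p; set TS := [set _ | _ in _].
have [h1 h2] := reebP SB sEB omB ndB (XB p).
have [lb ab] := skew_dform SB sEB (XB p).
have cx0 : codom_chart (C (pref A p)) x0 := codom_pcoord SA p.
have et a : pairing (EB (XB p)) ('D_a (F p) x0) = 0 by rewrite pairing_tangent.
have aux (P Q S : R) : P = 0 -> Q = 0 -> P + Q * S = 0.
  by move=> -> ->; rewrite mul0r addr0.
have dr V : dform B EB (XB p) V (reeb B EB (XB p)) = 0 by rewrite ab h2 oppr0.
apply/seteqP; split=> [_ [a _ <-]|_ [al Hal <-]].
  (* The covector flat W annihilates the tangent space by isotropy, and its value on the Reeb vector
     is eta_bar(W) = 0, so [sharp_Lambda] sends it back to W. *)
  set W := 'D_a (F p) x0; exists (flat B EB (XB p) W).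
    move=> _ [b _ <-]; apply: etrans (flatE SB sEB _ _ _) _.
    exact: aux (dform_tangent p a b) (et a).
  rewrite /sharp_Lambda (sharpE SB sEB omB ndB (erefl _)).
  have k0 : pairing (flat B EB (XB p) W) (reeb B EB (XB p)) = 0.
    by apply: etrans (flatE SB sEB _ _ _) _; exact: aux (dr W) (et a).
  by rewrite k0 scale0r subr0.
set V := sharp B EB (XB p) al; set w := sharp_Lambda B EB (XB p) al.
have ew : pairing (EB (XB p)) w = 0 by exact: pairing_sharp_Lambda.
(* [w] and [V] differ by a multiple of the Reeb vector, invisible to d eta_bar; and flat V = al
   vanishes on tangent vectors, which lie in ker eta_bar. *)
have dw a : dform B EB (XB p) w ('D_a (F p) x0) = 0.
  have Ha : pairing al ('D_a (F p) x0) = 0 by apply: Hal; exists a.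
  have wE : w = (- pairing al (reeb B EB (XB p))) *: reeb B EB (XB p) + V.
    by rewrite /w /sharp_Lambda scaleNr addrC.
  rewrite wE lb h2 mulr0 add0r.
  have := flatE SB sEB (XB p) V ('D_a (F p) x0).
  by rewrite (flat_sharp SB sEB omB ndB) Ha et mulr0 addr0.
(* A tangent vector of the image is determined by its base part, so the only candidate is [D], the
   one over the base part of [w]; [w - D] is vertical and has to be 0. *)
exists (xpart w) => //; set a := xpart w; apply/eqP; rewrite eq_sym -subr_eq0; apply/eqP.
set D := 'D_a (F p) x0 in et dw *.
have DE c : 'D_c (F p) x0 = jet c ('D_c (local_vf A X (C (pref A p))) x0)
    ('D_c (fX A eta X \o cinv (C (pref A p))) x0).
  exact (derive_FX SA seta om nd sX c cx0).
have xD : xpart D = a by rewrite /D DE xpart_jet.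
have wD : w - D = jet 0 (vpart (w - D)) (tpart (w - D)).
  by rewrite -{1}(jetK (w - D)) xpartB xD subrr.
set b := vpart _ in wD; set s := tpart _ in wD.
(* Any c is the base part of a tangent vector of the image, and d eta_bar of a vertical vector
   against it depends only on c. *)
have H c : dform A eta p b c + s * pairing (eta p) c = 0.
  have := dform_eta_bar SA seta p (X p) (fX A eta X p) b s c
    ('D_c (local_vf A X (C (pref A p))) x0)
    ('D_c (fX A eta X \o cinv (C (pref A p))) x0).
  rewrite -wD -DE => <-.
  have -> : w - D = (-1) *: D + w by rewrite scaleN1r addrC.
  apply: etrans (lb _ _ _ _) _.
  by rewrite dw addr0 dform_tangent mulr0.
have eb : pairing (eta p) b = 0.
  have := @pairing_eta_bar _ _ _ A eta p (X p) (fX A eta X p) 0 b s.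
  rewrite -wD pairingBr ew et subrr !pairing0r mulr0 addr0 add0r.
  by move=> ->.
have [b0 s0] := vertical_kernel SA seta om nd H eb.
by rewrite wD b0 s0 /jet (_ : const_mx 0 = 0) ?row_mx0.
Qed.

End Isotropic.

(** * The image of X_bar as a submanifold *)

Section Slice.
Variable i : chart_index A.

Definition shear (y : 'rV[R]_(m + m + 1)) : 'rV[R]_(m + m + 1) :=
  jet (xpart y) (vpart y + local_vf A X (C i) (xpart y))
    (tpart y + (fX A eta X \o cinv (C i)) (xpart y)).

Definition unshear (y : 'rV[R]_(m + m + 1)) : 'rV[R]_(m + m + 1) :=
  jet (xpart y) (vpart y - local_vf A X (C i) (xpart y))
    (tpart y - (fX A eta X \o cinv (C i)) (xpart y)).

(* In these coordinates (x, v - X(x), t - fX(x)) the image of X_bar is the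
   slice where the last m + 1 coordinates vanish. *)
Definition shear_chart : chart R (T * 'rV[R]_m * R) (m + m + 1) :=
  {| cdom := cdom (CB i);
     coord := unshear \o coord (CB i);
     cinv := cinv (CB i) \o shear |}.

Lemma unshearK : cancel unshear shear.
Proof.
move=> y; rewrite /shear /unshear xpart_jet vpart_jet tpart_jet !subrK.
exact: jetK.
Qed.

Lemma shearK : cancel shear unshear.
Proof.
move=> y; rewrite /shear /unshear xpart_jet vpart_jet tpart_jet !addrK.
exact: jetK.
Qed.

Lemma overlap_unshear (c : chart R (T * 'rV[R]_m * R) (m + m + 1)) :
  overlap shear_chart c = shear @^-1` overlap (CB i) c.
Proof.
apply/seteqP; split=> [_ [q cq <-]|y [q cq qy]].
  by exists q => //=; rewrite unshearK.
by exists q => //; rewrite -[LHS]/(unshear (coord (CB i) q)) qy shearK.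
Qed.

Lemma smooth_shear (U : set 'rV[R]_(m + m + 1)) : open U ->
  (forall y, U y -> codom_chart (C i) (xpart y)) ->
  smooth_on U shear /\ smooth_on U unshear.
Proof.
move=> oU US; have oc := open_codom SA (i := i).
have sx := smooth_xpart oU; have sv := smooth_vpart oU; have st := smooth_tpart oU.
have sXx := smooth_on_comp oU oc US sx (@sX i).
have sfx := smooth_on_comp_fun oU US sx (smooth_fX SA seta om nd sX (i := i)).
have sXn : smooth_on U (fun y => - (local_vf A X (C i) (xpart y))).
  apply/(smooth_on_mx oU) => k l.
  refine (smooth_on_ext oU _ (smooth_onN oU (proj1 (smooth_on_mx oU _) sXx k l))) => y _.
  by rewrite [RHS]mxE.
split; first exact (smooth_jet oU sx (smooth_onD oU sv sXx) (smooth_onD oU st sfx)).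
exact (smooth_jet oU sx (smooth_onD oU sv sXn) (smooth_onD oU st (smooth_onN oU sfx))).
Qed.

Lemma xpart_shear y : xpart (shear y) = xpart y.
Proof. by rewrite /shear xpart_jet. Qed.

Lemma xpart_unshear y : xpart (unshear y) = xpart y.
Proof. by rewrite /unshear xpart_jet. Qed.

(** Overlaps of induced charts depend on the base part only, and the shear fixes it. *)
Lemma overlap_shear j :
  overlap shear_chart (CB j) = overlap (CB i) (CB j).
Proof.
rewrite overlap_unshear; apply/seteqP.
by split=> y /(overlapB SA) H; apply/(overlapB SA); move: H; rewrite xpart_shear.
Qed.

Lemma slice_shear : slice_chart B (range XB) m shear_chart.
Proof.
have cod : codom_chart shear_chart = codom_chart (CB i).
  rewrite -(overlap_self (CB i)) -overlap_shear /overlap.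
  by rewrite -[cdom (CB i)]/(cdom shear_chart) setIid.
have vc := validC SB i.
split.
- split; last by rewrite cod; exact: (open_codom SB (i := i)).
  by move=> q cq; rewrite /= unshearK; exact: coordK vc cq.
- move=> j; set O := overlap (CB i) (CB j).
  have oO : open O := open_overlap (compatC SB i j).
  have oO' : open (overlap (CB j) (CB i)) := open_overlap (compatC SB j i).
  have OS y : O y -> codom_chart (C i) (xpart y).
    by move=> /(overlapB SA)/(overlapP _ _ (validC SA i))[].
  have O'S y : overlap (CB j) (CB i) y -> O (trans (CB j) (CB i) y).
    by move=> oy; apply: (trans_overlap (validC SB j)).
  have [s1 _] := smooth_shear oO OS.
  have [_ s2] := smooth_shear oO OS.
  have OS2 y : O y -> O (shear y).
    by move=> /(overlapB SA) H; apply/(overlapB SA); rewrite xpart_shear.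
  (* Transitions out of the sheared chart are [shear] followed by an ordinary transition; those into
     it are an ordinary transition followed by [unshear]. *)
  have ts := smooth_on_comp oO oO OS2 s1 (smooth_trans (compatC SB i j)).
  have ts' := smooth_on_comp oO' oO O'S (smooth_trans (compatC SB j i)) s2.
  have OE : overlap shear_chart (charts B j) = O := overlap_shear j.
  apply: compatible_overlap.
  + rewrite OE; exact oO.
  + exact oO'.
  + rewrite OE; exact ts.
  + exact ts'.
- move=> q cq; have cq' : cdom (C i) q.1.1 by exact: cq.
  set y := coord (CB i) q.
  have xy : xpart y = coord (C i) q.1.1 by rewrite /y /= xpart_jet.
  have cE : cinv (CB i) y = q := coordK vc cq.
  have cy : codom_chart (C i) (xpart y) by rewrite xy; exists q.1.1.
  have NE : range XB q <-> y = FX (A := A) eta X i (xpart y).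
    split=> [[p _ pq]|yF].
      have cp : cdom (C i) p by move: cq'; rewrite -pq.
      have yE := etrans (congr1 (coord (CB i)) (esym pq)) (coord_X_bar SA eta X cp).
      have xE : xpart y = coord (C i) p by rewrite /y yE xpart_jet.
      by rewrite xE; exact: yE.
    exists (cinv (C i) (xpart y)); first by [].
    apply: etrans (esym (cinv_FX SA eta X cy)) _.
    by rewrite -yF; exact: cE.
  have uE : coord shear_chart q = unshear y by [].
  rewrite uE; split=> [/NE yF k|H].
    (* On the image [y] is [FX] of its own base part, so both differences vanish; the indices k >= m
       are exactly those of the v block and the t entry. *)
    have -> : unshear y = jet (xpart y) 0 0.
      rewrite /unshear {2 4}yF /FX vpart_jet tpart_jet.
      by rewrite !subrr.
    move=> mk; case: (split_ordP k) mk => k' ->; last by rewrite /jet row_mxEr mxE.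
    rewrite /jet row_mxEl; case: (split_ordP k') => k'' -> /=; last by rewrite row_mxEr mxE.
    by rewrite leqNgt ltn_ord.
  apply/NE; rewrite -[LHS]unshearK /FX /shear xpart_unshear.
  have v0 : vpart (unshear y) = 0.
    apply/rowP => k; rewrite [RHS]mxE /vpart.
    by have := H (lshift 1 (rshift m k)); rewrite /= leq_addr => /(_ isT) <-; rewrite !mxE.
  have t0 : tpart (unshear y) = 0.
    by have := H (rshift (m + m) 0); rewrite /= addn0 leq_addr => /(_ isT) <-; rewrite /tpart mxE.
  by rewrite v0 t0 !add0r.
Qed.

End Slice.

Lemma submanifold_X_bar : submanifold B (range XB).
Proof.
exists m => q [p _ <-]; exists (shear_chart (pref A p)); split.
  exact: (cdom_pref SA p).
exact: slice_shear.
Qed.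

(** The image is a submanifold for every smooth X, so the tangent condition carries all the
    information. *)
Lemma legendrian_hamiltonian :
  legendrian B EB (range XB) <->
  exists H : T -> R, smooth_fun A H /\ X = hamiltonian_vf A eta H.
Proof.
apply: iff_trans (iff_sym (hamiltonian_lie SA seta om nd sX)).
split=> [[_ /tangent_perp_lie//]|L]; split; first exact: submanifold_X_bar.
exact: lie_tangent_perp.
Qed.

End Legendrian.

Theorem theorem12 (R : realType) (n : nat) (M : topologicalType)
    (A : atlas R M (n * 2).+1) (HM : smooth_manifold A)
    (eta : form1 R M (n * 2).+1) (Heta : contact_form A eta)
    (X : vfield R M (n * 2).+1) (HX : smooth_vf A X) :
  legendrian (times_line (tangent_atlas A)) (eta_bar A eta)
    (range (X_bar A eta X))
  <-> exists H : M -> R, smooth_fun A H /\ X = hamiltonian_vf A eta H.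
Proof.
have [_ _ SA _] := HM; have [seta w0] := Heta.
have om : odd (n * 2).+1 by rewrite /= muln2 odd_double.
apply: (legendrian_hamiltonian SA seta om _ HX) => p.
have [v Hv] := w0 p.
exact: wedge_nondegenerate (skew_dform SA seta p) Hv.
Qed.
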